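(* Let $P=\{p_1,\dots,p_d\}$ be a finite poset and $G$ a perfect graph on $[d]$. Let $\mathcal{R}_{P,G}=K[\{x_I\}_{I\in\mathcal{J}(P)}\cup\{y_S\}_{\emptyset\ne S\in S(G)}\cup\{z\}]$ and let $\pi:\mathcal{R}_{P,G}\to K[t_1,\dots,t_{d+1},s]$ be given by $\pi(x_I)=\mathbf{t}^{\rho(I)}t_{d+1}s$, $\pi(y_S)=\mathbf{t}^{\rho(S)}s$, $\pi(z)=s$, so that $\ker\pi=I_{\mathcal{O}_P*\mathcal{Q}_G}$. Let $<_{P,G}$ be any reverse lexicographic order on $\mathcal{R}_{P,G}$ induced by an ordering of the variables such that: $z<y_S<x_I$ for all $\emptyset\ne S\in S(G)$ and $I\in\mathcal{J}(P)$; $x_{I'}<x_I$ whenever $I'\supsetneq I$; and $y_{S'}<y_S$ whenever $\emptyset\ne S'\subsetneq S$. Let $\mathcal{G}_P=\{x_Ix_{I'}-x_{I\cap I'}x_{I\cup I'}: I,I'\in\mathcal{J}(P),\ I\not\subset I',\ I\not\supset I'\}$, let $\mathcal{G}_G\subset K[\{y_S\}_{\emptyset\ne S\in S(G)}\cup\{z\}]$ be the reduced Gröbner basis of the toric ideal of $\mathcal{Q}_G$ (the kernel of $y_S\mapsto\mathbf{t}^{\rho(S)}s$, $z\mapsto s$) with respect to the reverse lexicographic order induced by the restriction of the variable ordering, and let $\mathcal{G}=\{x_Iy_S-x_{I\cup\{s\}}y_{S\setminus\{s\}}: I\in\mathcal{J}(P),\ \emptyset\ne S\in S(G),\ s\in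 S\setminus I,\ I\cup\{s\}\in\mathcal{J}(P)\}$, where $y_\emptyset$ means $z$. Then $\mathcal{G}_P\cup\mathcal{G}_G\cup\mathcal{G}$ is a Gröbner basis of $I_{\mathcal{O}_P*\mathcal{Q}_G}$ with respect to $<_{P,G}$, and the initial ideal of $I_{\mathcal{O}_P*\mathcal{Q}_G}$ with respect to $<_{P,G}$ is squarefree (generated by squarefree monomials).
   Context: $K$ is a field. Identify $p_j$ with $j\in[d]$; for $X\subset[d]$, $\rho(X)=\sum_{j\in X}\mathbf{e}_j$ and $\mathbf{t}^{\mathbf{a}}=t_1^{a_1}\cdots t_d^{a_d}$. $\mathcal{J}(P)$ is the set of poset ideals (down-closed subsets, including $\emptyset$) of $P$; $S(G)$ is the set of stable sets of $G$ (vertex subsets containing no edge). $\mathcal{O}_P=\mathrm{conv}\{\rho(I):I\in\mathcal{J}(P)\}$, $\mathcal{Q}_G=\mathrm{conv}\{\rho(S):S\in S(G)\}$, and the Cayley sum $\mathcal{O}_P*\mathcal{Q}_G\subset\mathbb{R}^{d+1}$ is the convex hull of $(\mathcal{O}_P\times\{1\})\cup(\mathcal{Q}_G\times\{0\})$; its lattice points are $(\rho(I),1)$ and $(\rho(S),0)$. The toric ideal $I_{\mathcal{O}_P*\mathcal{Q}_G}$ is $\ker\pi$. A graph is perfect if every induced subgraph has chromatic number equal to its maximum clique size. *)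

(* Defs.v *)
From HB Require Import structures.
From mathcomp Require Import all_boot all_order all_algebra.
From mathcomp Require Import finmap.
From mathcomp.multinomials Require Import monalg.

Set Implicit Arguments.
Unset Strict Implicit.
Unset Printing Implicit Defensive.

Import GRing.Theory.

Local Open Scope ring_scope.

HB.lock Definition pvar (K : fieldType) (V : finType) (v : V) :
  {malg K[{cmonom V}]} := << ucm v >>.
Canonical pvar_unlockable := Unlockable pvar.unlock.

Definition psubst (K : fieldType) (V : finType) (A : comAlgType K)
    (a : V -> A) (f : {malg K[{cmonom V}]}) : A :=
  mmap (in_alg A) (fun m : {cmonom V} => \prod_(v : V) a v ^+ m v) f.

Section Groebner.
Context (K : fieldType) (V : finType).
Local Notation R := {malg K[{cmonom V}]}.

Definition ideal_gen (A : R -> Prop) (f : R) : Prop :=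
  exists s : seq (R * R),
    (forall p, p \in s -> A p.2) /\ f = \sum_(p <- s) p.1 * p.2.

Definition cmdvd (m1 m2 : {cmonom V}) : bool :=
  [forall v : V, (m1 v <= m2 v)%N].

Definition cmsquarefree (m : {cmonom V}) : bool :=
  [forall v : V, (m v <= 1)%N].

(* The graded reverse lexicographic order for the variable order [le]: for
   equal degrees, the monomial with the larger exponent at the smallest
   variable where the exponents differ is the smaller one. *)
Definition revlex_lt (le : rel V) : rel {cmonom V} := fun m1 m2 =>
  (mdeg m1 < mdeg m2)%N ||
  (mdeg m1 == mdeg m2) &&
  [exists v : V, (m2 v < m1 v)%N &&
    [forall w : V, (w != v) && le w v ==> (m1 w == m2 w)]].

Definition revlex (le : rel V) : rel {cmonom V} := fun m1 m2 =>
  (m1 == m2) || revlex_lt le m1 m2.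

Context (mle : rel {cmonom V}).

(* Never holds for [f = 0]. *)
Definition is_lead (f : R) (m : {cmonom V}) : Prop :=
  m \in msupp f /\ forall m', m' \in msupp f -> mle m' m.

Definition initial_ideal (I : R -> Prop) : R -> Prop :=
  ideal_gen (fun f => exists g m, I g /\ is_lead g m /\ f = << m >>).

Definition groebner_basis (I : R -> Prop) (B : {fset R}) : Prop :=
  [/\ forall g, g \in B -> g != 0,
      forall g, g \in B -> I g
    & forall f, initial_ideal I f <->
        ideal_gen (fun h => exists g m,
          g \in B /\ is_lead g m /\ h = << m >>) f].

Definition reduced_groebner_basis (I : R -> Prop) (B : {fset R}) : Prop :=
  [/\ groebner_basis I B,
      forall g m, g \in B -> is_lead g m -> g@_m = 1
    & forall g g' m u, g \in B -> g' \in B -> g != g' ->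
        is_lead g' m -> u \in msupp g -> ~~ cmdvd m u].

Definition gen_by_squarefree_monomials (I : R -> Prop) : Prop :=
  exists M : {cmonom V} -> Prop,
    (forall m, M m -> cmsquarefree m) /\
    forall f, I f <-> ideal_gen (fun h => exists2 m, M m & h = << m >>) f.

End Groebner.

Section ToricIdeal.
Context (K : fieldType) (V : finType) (n : nat).

(* The ring K[t_1, ..., t_n, s] has its variables indexed by [option 'I_n]:
   [Some j] stands for t_j and [None] for s. *)
Definition toric_map (a : V -> 'rV[nat]_n) :
    {malg K[{cmonom V}]} -> {malg K[{cmonom option 'I_n}]} :=
  psubst (fun v =>
    (\prod_(j < n) pvar K (Some j) ^+ a v 0 j) * pvar K None).

Definition toric_ideal (a : V -> 'rV[nat]_n) (f : {malg K[{cmonom V}]}) :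
  Prop := toric_map a f = 0.

End ToricIdeal.

Section Graphs.
Context (d : nat) (e : rel 'I_d).
Implicit Types S W C : {set 'I_d}.

Definition stable_set S : bool := [forall i in S, forall j in S, ~~ e i j].

Definition clique C : bool :=
  [forall i in C, forall j in C, (i != j) ==> e i j].

Definition clique_number W : nat :=
  \max_(C : {set 'I_d} | (C \subset W) && clique C) #|C|.

Definition proper_coloring W (c : {ffun 'I_d -> 'I_d}) : bool :=
  [forall i in W, forall j in W, e i j ==> (c i != c j)].

(* Least number of colours used on [W]; [d] colours always suffice, so the
   restriction to colours in ['I_d] and the default value [d] are harmless. *)
Definition chromatic_number W : nat :=
  \big[minn/d]_(c : {ffun 'I_d -> 'I_d} | proper_coloring W c) #|c @: W|.

Definition perfect : Prop :=
  forall W : {set 'I_d}, chromatic_number W = clique_number W.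

Lemma stable_set0 : stable_set set0.
Proof. by apply/forall_inP => i; rewrite inE. Qed.

End Graphs.

Section OrderStable.
Context (K : fieldType) (d : nat) (leP e : rel 'I_d).
Implicit Types I S : {set 'I_d}.

Definition poset_ideal I : bool :=
  [forall j in I, forall i, leP i j ==> (i \in I)].

Definition ideals := {I : {set 'I_d} | poset_ideal I}.
Definition stables := {S : {set 'I_d} | stable_set e S}.

(* [inl I] indexes x_I and [inr S] indexes y_S, where y_emptyset is z. *)
Definition cvar := (ideals + stables)%type.

Definition zind : stables := exist _ set0 (stable_set0 e).

Definition rho (X : {set 'I_d}) : 'rV[nat]_d := \row_j (j \in X : nat).

(* The lattice points of the Cayley sum of the order polytope and the stable
   set polytope; [stable_point] lists those of the latter alone. *)
Definition cayley_point (v : cvar) : 'rV[nat]_(d + 1) :=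
  match v with
  | inl u => row_mx (rho (val u)) (const_mx 1%N)
  | inr u => row_mx (rho (val u)) (const_mx 0%N)
  end.

Definition stable_point (S : stables) : 'rV[nat]_d := rho (val S).

Local Notation R := {malg K[{cmonom cvar}]}.

(* The value 0 outside poset ideals, respectively stable sets, is a dummy. *)
Definition xvar I : R := if insub I is Some u then pvar K (inl u) else 0.
Definition yvar S : R := if insub S is Some u then pvar K (inr u) else 0.

Definition yz_embed : {malg K[{cmonom stables}]} -> R :=
  psubst (fun u : stables => pvar K (inr u)).

Definition poset_binomials : {fset R} :=
  [fset (let: (I1, I2) := u in
         xvar I1 * xvar I2 - xvar (I1 :&: I2) * xvar (I1 :|: I2))
    | u in [set u : {set 'I_d} * {set 'I_d} |
        let: (I1, I2) := u in
        [&& poset_ideal I1, poset_ideal I2, ~~ (I1 \subset I2)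
          & ~~ (I2 \subset I1)]]]%fset.

Definition mixed_binomials : {fset R} :=
  [fset (let: (I1, S1, s) := u in
         xvar I1 * yvar S1 - xvar (s |: I1) * yvar (S1 :\ s))
    | u in [set u : {set 'I_d} * {set 'I_d} * 'I_d |
        let: (I1, S1, s) := u in
        [&& poset_ideal I1, stable_set e S1, S1 != set0,
            s \in S1 :\: I1 & poset_ideal (s |: I1)]]]%fset.

Definition admissible_order (lev : rel cvar) : Prop :=
  let ltv := [rel v w | (v != w) && lev v w] in
  [/\ reflexive lev, antisymmetric lev, transitive lev & total lev] /\
  [/\ forall (S : stables) (I : ideals), val S != set0 ->
        ltv (inr zind) (inr S) && ltv (inr S) (inl I),
      forall I I' : ideals, val I \proper val I' -> ltv (inl I') (inl I)
    & forall S S' : stables, val S' != set0 -> val S' \proper val S ->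
        ltv (inr S') (inr S)].

Definition yz_order (lev : rel cvar) : rel stables :=
  fun u v => lev (inr u) (inr v).

End OrderStable.

(* Main.v *)
Require Import Defs.
From HB Require Import structures.
From mathcomp Require Import all_boot all_order all_algebra.
From mathcomp Require Import finmap zify.
From mathcomp.multinomials Require Import monalg.

(* A monomial lies in the initial ideal of a toric ideal exactly when it is not
   the smallest monomial of its fibre.  Suppose the ideals I with x_I dividing
   m form a chain, no leading term x_I y_S of a mixed binomial divides m, and
   the y-part of m is smallest in its own fibre.  Then m is determined by its
   image: if two such monomials have the same image, take j minimal in P such
   that their numbers of ideals containing j differ.  The one with fewer such
   ideals has some y_S with j in S and some x_I with j outside I; for the
   largest such I, some k < j lies outside I, and k is covered no more often
   than j, which contradicts the minimality of j.  Hence every monomial that is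
   not smallest in its fibre is divisible by one of the claimed leading terms.

   For squarefreeness only the y-part matters.  As G is perfect, every integral
   p >= 0 with p(C) <= k for all cliques C is a sum of k stable sets (weighted
   colouring, by Lovász's replication argument).  Since the functionals
   k - p(C) and p(j) take only the values 0 and 1 on stable sets, whether a
   monomial is smallest in its fibre depends on its support alone. *)

Set Implicit Arguments.
Unset Strict Implicit.
Unset Printing Implicit Defensive.

Import GRing.Theory.

Local Open Scope ring_scope.

Local Notation "m1 *' m2" := (mmul m1 m2) (at level 40, left associativity).
Local Notation coef m f := (@mcoeff {cmonom _} _ m f).

(** * Weighted colourings of perfect graphs *)

Section WeightedColouring.
Local Open Scope nat_scope.
Context (d : nat) (e : rel 'I_d).
Hypotheses (e_irrefl : irreflexive e) (e_perfect : perfect e).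
Implicit Types (S C W : {set 'I_d}) (p : 'I_d -> nat).

Lemma stable_setS S S' : S' \subset S -> stable_set e S -> stable_set e S'.
Proof.
move=> /subsetP sS /forall_inP stS; apply/forall_inP=> i /sS iS.
by apply/forall_inP=> j /sS jS; have /forall_inP := stS i iS; apply.
Qed.

Lemma clique_stable_card C S : clique e C -> stable_set e S -> (#|C :&: S| <= 1)%N.
Proof.
move=> /forall_inP clC /forall_inP stS; apply/card_le1_eqP=> j i.
rewrite !inE => /andP[jC jS] /andP[iC iS]; apply/eqP/negPn/negP=> nij.
have /forall_inP/(_ j jC)/implyP/(_ nij) eij := clC i iC.
by have /forall_inP/(_ j jS) := stS i iS; rewrite eij.
Qed.

Lemma sum_nat_mem C S : (\sum_(j in C) (j \in S : nat) = #|C :&: S|)%N.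
Proof.
rewrite -sum1_card big_mkcond [RHS]big_mkcond; apply: eq_bigr=> j _.
by rewrite inE; case: (j \in C); case: (j \in S).
Qed.

(** The minimum has default value [d]; if it equals [d], the identity colouring, proper because [e]
    is irreflexive, uses at most that many colours. *)
Lemma chromatic_attained W :
  exists2 c : {ffun 'I_d -> 'I_d}, proper_coloring e W c & (#|c @: W| <= chromatic_number e W)%N.
Proof.
have idP : proper_coloring e W [ffun i => i].
  apply/forall_inP=> i _; apply/forall_inP=> j _; apply/implyP.
  by rewrite !ffunE; apply: contraTneq => ->; rewrite e_irrefl.
pose Q n := n = d \/ exists2 c, proper_coloring e W c & (#|c @: W| <= n)%N.
have [Ed|//] : Q (chromatic_number e W).
  apply: (big_rec Q); first by left.
  move=> c n cP IH; rewrite /minn; case: ifP => _ //.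
  by right; exists c.
exists [ffun i => i]; rewrite // Ed.
by apply: leq_trans (max_card _) _; rewrite card_ord.
Qed.

(* Lovász replication: lowering a weight p v >= 2 to p v - 1 and colouring
   that first yields a stable set through v that meets every clique of
   p-weight k, because such a clique either contains v or is met by all k
   colour classes. *)
Lemma perfect_weighted_colouring p k :
  (forall C, clique e C -> \sum_(j in C) p j <= k)%N ->
  exists s : seq {set 'I_d}, [/\ size s = k, all (stable_set e) s
    & forall j, p j = (\sum_(S <- s) (j \in S))%N].
Proof.
have [n] := ubnP (\sum_j p j); elim: n p k => // n IHn p k ltn pC.
case: (boolP [exists v, 1 < p v]%N) => [/existsP[v pv]|].
  (* [q] is still positive at [v], so a colouring of [q] has a class through [v]. *)
  pose q j := (p j - (j == v))%N.
  have qp j : p j = (q j + (j == v))%N.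
    by rewrite /q; case: (eqVneq j v) => [->|_]; rewrite ?subn0 ?addn0 //; lia.
  have sum_qp : (\sum_j p j = (\sum_j q j) + 1)%N.
    rewrite (eq_bigr (fun j => q j + (j == v))%N) // big_split /=; congr addn.
    by rewrite (bigD1 v) //= eqxx big1 // => i /negPf ->.
  have [||s [szs /allP sts qE]] := IHn q k; first by lia.
    move=> C clC; apply: leq_trans (pC C clC); apply: leq_sum=> j _.
    by rewrite /q leq_subr.
  have qv : (0 < q v)%N by rewrite /q eqxx; lia.
  have [S Ss vS] : exists2 S, S \in s & v \in S.
    apply/hasP; apply: contraLR qv; rewrite -all_predC => /allP vs.
    rewrite qE big_seq big1 // => S /vs /=; by case: (v \in S).
  have stS := sts S Ss.
  (* Every vertex of [S] has positive weight, so this subtraction is never truncated. *)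
  pose r j := (p j - (j \in S))%N.
  have rp j : p j = (r j + (j \in S))%N.
    rewrite /r subnK // qp qE (perm_big _ (perm_to_rem Ss)) big_cons.
    by rewrite -addnA leq_addr.
  have k0 : (0 < k)%N.
    by rewrite -szs; case: (s) Ss.
  have [||s' [szs' sts' rE]] := IHn r k.-1.
  - suff: (\sum_j r j < \sum_j p j)%N by lia.
    rewrite (eq_bigr _ (fun j _ => rp j)) big_split /= (bigD1 v) //=.
    by rewrite [X in (_ < _ + X)%N](bigD1 v) //= vS; lia.
  - move=> C clC; have := pC C clC; rewrite leq_eqVlt => /orP[/eqP Ck|]; last first.
      move=> lt; suff: (\sum_(j in C) r j <= \sum_(j in C) p j)%N by lia.
      by apply: leq_sum=> j _; rewrite /r leq_subr.
    have : (\sum_(j in C) p j = \sum_(j in C) r j + #|C :&: S|)%N.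
      by rewrite -sum_nat_mem -big_split /=; apply: eq_bigr => j _; rewrite -rp.
    suff : (0 < #|C :&: S|)%N by lia.
    (* If [C] missed [S], then [v] would lie outside [C] and [C] would have [q]-weight [k], although
       the [k - 1] classes other than [S] meet it at most once each. *)
    apply/negPn/negP; rewrite -leqNgt leqn0 cards_eq0 => /eqP CS0.
    have vC : v \notin C.
      by apply/negP=> vC; have /setP/(_ v) := CS0; rewrite !inE vC vS.
    have : (\sum_(j in C) q j = k)%N.
      rewrite -Ck; apply: eq_bigr => j jC; rewrite qp; case: eqP => [E|]; last by rewrite addn0.
      by rewrite -E jC in vC.
    rewrite (eq_bigr _ (fun j _ => qE j)) exchange_big /=.
    rewrite (perm_big _ (perm_to_rem Ss)) big_cons /= sum_nat_mem CS0 cards0 add0n.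
    have := size_rem Ss; rewrite szs => szr.
    suff : (\sum_(S' <- rem S s) \sum_(i in C) (i \in S') <= size (rem S s))%N.
      by move=> le Ek; move: le; rewrite Ek szr; lia.
    rewrite -sum1_size !big_seq; apply: leq_sum => S' /mem_rem S's.
    by rewrite sum_nat_mem; apply: clique_stable_card => //; apply: sts.
  exists (S :: s'); split=> /=; first by rewrite szs'; lia.
    by rewrite stS.
  by move=> j; rewrite big_cons rp rE addnC.
rewrite negb_exists => /forallP p1.
have {}p1 j : (p j <= 1)%N by have := p1 j; lia.
(* All weights are now 0 or 1, so [p] is the indicator of [W]; cliques in [W] have at most [k]
   vertices, and perfection turns this into a colouring. *)
pose W := [set j | p j == 1%N].
have pW j : p j = (j \in W) by rewrite inE; have := p1 j; case: (p j) => [|[|]].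
have [c /forall_inP cP cW] := chromatic_attained W.
have cWk : (#|c @: W| <= k)%N.
  apply: leq_trans cW _; rewrite e_perfect; apply/bigmax_leqP => C /andP[CW clC].
  apply: leq_trans (pC C clC); rewrite -sum1_card; apply: leq_sum => j jC.
  by rewrite pW (subsetP CW).
pose s := [seq [set j in W | c j == i] | i <- enum (c @: W)].
(* Empty sets pad the colour classes to exactly [k] members. *)
exists (s ++ nseq (k - #|c @: W|) set0); split.
- by rewrite size_cat size_nseq size_map -cardE; lia.
- rewrite all_cat all_nseq stable_set0 orbT andbT; apply/allP => S /mapP[i _ ->].
  apply/forall_inP => j; rewrite inE => /andP[jW /eqP cj]; apply/forall_inP => l.
  rewrite inE => /andP[lW /eqP cl].
  have /forall_inP/(_ l lW)/implyP := cP j jW.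
  by rewrite cj cl eqxx => /contraNN; apply.
move=> j; rewrite big_cat /= big_map [X in (_ + X)%N]big1_seq => [|S /=]; last first.
  by rewrite mem_nseq => /andP[_ /eqP ->]; rewrite inE.
rewrite addn0 pW big_enum /=.
case: (boolP (j \in W)) => jW; last first.
  by rewrite big1 // => i _; rewrite in_set (negPf jW).
rewrite (bigD1 (c j)) ?imset_f //= in_set jW eqxx big1 // => i /andP[_ ni].
by rewrite in_set jW eq_sym (negPf ni).
Qed.

End WeightedColouring.

(* Locked, as [mono] below: otherwise failing unifications diverge. *)
HB.lock Definition cmfun (V : finType) (f : V -> nat) : {cmonom V} :=
  [cmonom f i | i in [fset x | x in V]%fset]%M.

(** * Monomials as exponent functions *)

Section Monomials.
Local Open Scope nat_scope.
Context (V : finType).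
Implicit Types (m : {cmonom V}) (f : V -> nat).

Lemma cmfunE f v : cmfun f v = f v.
Proof. by rewrite unlock cmE fsfunE in_fset. Qed.

Lemma cm_ext m1 m2 : (forall v, m1 v = m2 v) -> m1 = m2.
Proof. by move=> E; apply/eqP/cmP. Qed.

Lemma mdeg_sum m : mdeg m = (\sum_v m v)%N.
Proof.
rewrite (@mdegEw _ _ [fset x | x in V]%fset); last first.
  by apply/fsubsetP=> v _; rewrite in_fset.
apply: perm_big; apply: uniq_perm; rewrite ?fset_uniq ?index_enum_uniq // => v.
by rewrite mem_index_enum in_fset.
Qed.

Lemma cm_le_mdeg m v : (m v <= mdeg m)%N.
Proof. by rewrite mdeg_sum (bigD1 v) //= leq_addr. Qed.

Lemma cmdvdP m1 m2 : reflect (forall v, (m1 v <= m2 v)%N) (cmdvd m1 m2).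
Proof. exact: forallP. Qed.

Lemma cmdvd_mulP m1 m2 : cmdvd m1 m2 -> m2 = (cmfun (fun v => m2 v - m1 v)%N *' m1).
Proof.
by move=> /cmdvdP le12; apply: cm_ext => v; rewrite cmM cmfunE subnK.
Qed.

End Monomials.

(** * The graded reverse lexicographic order *)

Section Revlex.
Local Open Scope nat_scope.
Context (V : finType) (le : rel V).
Hypotheses (le_refl : reflexive le) (le_anti : antisymmetric le)
  (le_trans : transitive le) (le_total : total le).
Implicit Types (m : {cmonom V}).

Lemma revlex_ltP m1 m2 : mdeg m1 = mdeg m2 ->
  reflect (exists2 v, (m2 v < m1 v)%N & forall w, w != v -> le w v -> m1 w = m2 w)
    (revlex_lt le m1 m2).
Proof.
move=> E; rewrite /revlex_lt E ltnn eqxx /=; apply: (iffP existsP) => -[v].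
  move=> /andP[lt12 /forallP eq12]; exists v => // w nwv lwv.
  by have := eq12 w; rewrite nwv lwv => /eqP.
move=> lt12 eq12; exists v; rewrite lt12; apply/forallP=> w.
by apply/implyP=> /andP[nwv lwv]; rewrite eq12.
Qed.

Lemma revlex_lt_mdeg m1 m2 : revlex_lt le m1 m2 -> (mdeg m1 <= mdeg m2)%N.
Proof. by move=> /orP[/ltnW|/andP[/eqP->]]. Qed.

Lemma revlex_ltxx m : revlex_lt le m m = false.
Proof. by apply/negP=> /(revlex_ltP (erefl _))[v]; rewrite ltnn. Qed.

(** The smaller of the two deciding variables decides between [m1] and [m3]; if they coincide, the
    inequalities there compose. *)
Lemma revlex_lt_trans m2 m1 m3 : mdeg m1 = mdeg m2 -> mdeg m2 = mdeg m3 ->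
  revlex_lt le m1 m2 -> revlex_lt le m2 m3 -> revlex_lt le m1 m3.
Proof.
move=> E12 E23 /(revlex_ltP E12)[v lt_v eq_v] /(revlex_ltP E23)[w lt_w eq_w].
apply/revlex_ltP; first by rewrite E12.
case: (eqVneq v w) => [Evw|nvw].
  subst w; exists v; first exact: ltn_trans lt_v.
  by move=> u nu lu; rewrite eq_v // eq_w.
have anti u x y : u != x -> le u x -> le x y -> u != y.
  by move=> nux lux lxy; apply: contraNneq nux => Euy; rewrite Euy in lux *;
    apply/eqP/le_anti; rewrite lux lxy.
have [lvw|lwv] := orP (le_total v w).
  exists v; first by rewrite -(eq_w v).
  move=> u nuv luv; rewrite eq_v // eq_w //; first exact: anti luv lvw.
  exact: le_trans lvw.
exists w; first by rewrite (eq_v w) // eq_sym.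
move=> u nuw luw; rewrite eq_v ?eq_w //; first exact: anti luw lwv.
exact: le_trans lwv.
Qed.

Lemma revlex_lt_total m1 m2 : mdeg m1 = mdeg m2 -> m1 != m2 ->
  revlex_lt le m1 m2 || revlex_lt le m2 m1.
Proof.
(* [rank] numbers the variables along [le], so that a smallest variable with different exponents can
   be chosen. *)
move=> E n12; pose rank v := #|[set w | le w v]|.
have rank_lt w v : w != v -> le w v -> (rank w < rank v)%N.
  move=> nwv lwv; apply/proper_card/properP; split.
    by apply/subsetP=> u; rewrite !inE => luw; apply: le_trans lwv.
  exists v; rewrite !inE ?le_refl //; apply: contra nwv => lvw.
  by apply/eqP/le_anti; rewrite lwv lvw.
have [v0 nv0] : exists v, m1 v != m2 v.
  apply/existsP; apply: contraNT n12; rewrite negb_exists => /forallP eq12.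
  by apply/eqP/cm_ext => v; have := eq12 v; rewrite negbK => /eqP.
case: (@arg_minnP _ v0 (fun v => m1 v != m2 v) rank nv0) => v nv minv.
have eqlt w : w != v -> le w v -> m1 w = m2 w.
  move=> nwv lwv; apply/eqP; apply: contraTT (rank_lt _ _ nwv lwv) => nw.
  by rewrite -leqNgt minv.
case: (ltngtP (m1 v) (m2 v)) => [lt12|lt21|/eqP]; last by rewrite (negPf nv).
  apply/orP; right; apply/revlex_ltP => //; exists v => // w nwv lwv.
  by rewrite eqlt.
by apply/orP; left; apply/revlex_ltP => //; exists v.
Qed.

Lemma revlex_ltM m1 m2 m : mdeg m1 = mdeg m2 ->
  revlex_lt le m1 m2 -> revlex_lt le (m *' m1) (m *' m2).
Proof.
move=> E /(revlex_ltP E)[v lt_v eq_v]; apply/revlex_ltP; first by rewrite !mdegM E.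
exists v; first by rewrite !cmM ltn_add2l.
by move=> w nwv lwv; rewrite !cmM eq_v.
Qed.

(** Exponents are bounded by the degree, so only finitely many monomials compete; descent ends by
    induction on the number of monomials below. *)
Lemma revlex_min (P : pred {cmonom V}) m : P m ->
  exists m0, [/\ P m0, mdeg m0 = mdeg m
    & forall m', P m' -> mdeg m' = mdeg m -> ~~ revlex_lt le m' m0].
Proof.
set n := mdeg m => Pm.
pose mon (g : {ffun V -> 'I_n.+1}) := cmfun (fun v => g v : nat).
have monK m' : mdeg m' = n -> exists g, mon g = m'.
  move=> E; exists [ffun v => inord (m' v)]; apply: cm_ext => v.
  by rewrite cmfunE ffunE inordK // ltnS -E cm_le_mdeg.
pose below m' := [pred g | (mdeg (mon g) == n) && revlex_lt le (mon g) m'].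
suff aux N m1 : P m1 -> mdeg m1 = n -> (#|below m1| < N)%N ->
    exists m0, [/\ P m0, mdeg m0 = n & forall m', P m' -> mdeg m' = n -> ~~ revlex_lt le m' m0].
  exact: (aux _ m Pm (erefl _) (ltnSn _)).
elim: N m1 => // N IHN m1 Pm1 E1 ltN.
case: (pickP [pred g | below m1 g && P (mon g)]) => [g /andP[/andP[/eqP Eg lt1] Pg]|none].
  apply: (IHN (mon g)) => //; rewrite -ltnS; apply: leq_ltn_trans ltN.
  apply: proper_card; apply/properP; split.
    apply/subsetP=> h /andP[/eqP Eh lth]; rewrite inE Eh eqxx /=.
    by apply: revlex_lt_trans lth lt1; rewrite ?Eh ?Eg ?E1.
  by exists g; rewrite !inE ?Eg ?eqxx ?lt1 ?revlex_ltxx.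
exists m1; split=> // m' Pm' E'; apply/negP=> lt'.
have [g Eg] := monK m' E'.
by have := none g; rewrite /= Eg E' eqxx lt' Pm'.
Qed.

End Revlex.

(** * Monomials as elements of the polynomial ring *)

HB.lock Definition mono (K : fieldType) (V : finType) (m : {cmonom V}) :
  {malg K[{cmonom V}]} := << m >>.

Section MonomialElements.
Context (K : fieldType) (V : finType).
Local Notation R := {malg K[{cmonom V}]}.
Local Notation mono := (@mono K V).
Implicit Types (f : R) (m : {cmonom V}).

Lemma monoE m : << m >> = mono m.
Proof. by rewrite unlock. Qed.

Lemma coef_mono m k : coef k (mono m) = (m == k)%:R.
Proof. rewrite unlock; exact: (@mcoeffU {cmonom V} K m 1 k). Qed.

Lemma coefZ c f k : coef k (c *: f) = c * coef k f.
Proof. exact: mcoeffZ. Qed.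

Lemma supp_mono m k : (k \in msupp (mono m)) = (k == m).
Proof.
rewrite -mcoeff_neq0 coef_mono [k == m]eq_sym.
by case: (m == k); rewrite ?mulr1n ?oner_eq0 ?eqxx.
Qed.

Lemma monoM m m' : mono (m *' m') = mono m * mono m'.
Proof. by rewrite !unlock malgM_def fgmulUU mulr1. Qed.

Lemma scale_mono c m : c *: mono m = << c *g m >>.
Proof.
by apply/malgP => k; rewrite coefZ coef_mono mulr_natr; apply/esym/mcoeffU.
Qed.

Lemma pvarE v : pvar K v = mono (ucm v).
Proof. by rewrite [pvar]unlock -monoE. Qed.

Lemma mono_prod m : mono m = \prod_v pvar K v ^+ m v.
Proof.
have mono1 : mono mone = 1 by rewrite -monoE.
have Xn (v : V) n : pvar K v ^+ n = mono (cmfun (fun w => (v == w) * n)%N).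
  elim: n => [|n IHn].
    by rewrite expr0 -mono1; congr mono; apply: cm_ext => w; rewrite cmfunE muln0 cm1.
  rewrite exprS IHn pvarE -monoM; congr mono; apply: cm_ext => w.
  by rewrite cmM !cmfunE cmU mulnS.
rewrite (eq_bigr (fun v => mono (cmfun (fun w => (v == w) * m v)%N))) => [|v _]; last first.
  exact: Xn.
rewrite -(big_morph mono monoM mono1); congr mono.
apply: cm_ext => w; rewrite (big_morph (fun m : {cmonom V} => m w) (cmM w) (cm1 w)).
rewrite (bigD1 w) //= cmfunE eqxx mul1n big1 ?addn0 // => v /negPf nv.
by rewrite cmfunE nv.
Qed.

End MonomialElements.

(** * Linear maps induced by maps of monomials *)

Section Pushforward.
Context (K : fieldType) (V W : finType) (h : {cmonom V} -> {cmonom W}).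
Local Notation R := {malg K[{cmonom V}]}.
Implicit Types (f : R) (m : {cmonom V}).

(** The [K]-linear extension of [h]. Toric maps and the inclusion of the y-variables both have this
    form, which allows arguing fibre by fibre of [h]. *)
Definition pushm : R -> {malg K[{cmonom W}]} :=
  mmap (in_alg {malg K[{cmonom W}]}) (fun m => mono K (h m)).

Lemma pushm_scale_mono c m : pushm (c *: mono K m) = c *: mono K (h m).
Proof. by rewrite scale_mono /pushm mmapU /= mulr_algl. Qed.

Lemma pushm_mono m : pushm (mono K m) = mono K (h m).
Proof. by rewrite -[mono K m]scale1r pushm_scale_mono scale1r. Qed.

Lemma pushm0 : pushm 0 = 0.
Proof. exact: raddf0. Qed.

Lemma pushmB f g : pushm (f - g) = pushm f - pushm g.
Proof. exact: raddfB. Qed.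

Lemma pushmE f : pushm f = \sum_(m <- msupp f) coef m f *: mono K (h m).
Proof. by rewrite /pushm mmapE; apply: eq_bigr => m _; rewrite /= mulr_algl. Qed.

Lemma coef_sum (I : Type) (s : seq I) (F : I -> {malg K[{cmonom W}]}) k :
  coef k (\sum_(i <- s) F i) = \sum_(i <- s) coef k (F i).
Proof. exact: raddf_sum. Qed.

Lemma coef_pushm f c : coef c (pushm f) = \sum_(m <- msupp f | h m == c) coef m f.
Proof.
rewrite pushmE coef_sum [RHS]big_mkcond /=; apply: eq_bigr => m _.
by rewrite coefZ coef_mono; case: eqP; rewrite ?mulr1 ?mulr0.
Qed.

(** The coefficient of [h m] in the image is the sum over the fibre of [m], and a single nonzero
    term cannot cancel. *)
Lemma pushm_kerP f m : pushm f = 0 -> m \in msupp f ->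
  exists m', [/\ m' \in msupp f, m' != m & h m' = h m].
Proof.
move=> f0 mf; case: (boolP (has (fun k => (k != m) && (h k == h m)) (msupp f))).
  by move=> /hasP[k kf /andP[nk /eqP hk]]; exists k.
rewrite -all_predC => /allP none; have : coef (h m) (pushm f) = 0 by rewrite f0 mcoeff0.
rewrite coef_pushm -big_filter (bigD1_seq m) ?filter_uniq ?fset_uniq ?mem_filter ?eqxx //=.
rewrite big1_seq ?addr0 => [/eqP|k]; first by rewrite mcoeff_eq0 mf.
rewrite mem_filter => /andP[nk /andP[hk kf]].
by have := none k kf; rewrite /= nk hk.
Qed.

Lemma pushm_binom m m' : h m = h m' -> pushm (mono K m - mono K m') = 0.
Proof. by move=> E; rewrite pushmB !pushm_mono E subrr. Qed.

Lemma coef_pushm_inj f m : injective h -> coef (h m) (pushm f) = coef m f.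
Proof.
move=> h_inj; rewrite coef_pushm (eq_bigl (pred1 m)); last first.
  by move=> k; rewrite /= (inj_eq h_inj).
case: (boolP (m \in msupp f)) => mf.
  by rewrite -big_filter filter_pred1_uniq ?fset_uniq // big_seq1.
rewrite big1_seq; first by rewrite mcoeff_outdom.
by move=> k /andP[/eqP -> ] kf; rewrite kf in mf.
Qed.

Lemma pushm_supp f k : k \in msupp (pushm f) -> exists2 m, m \in msupp f & k = h m.
Proof.
rewrite -mcoeff_neq0 coef_pushm => nz.
case: (boolP (has (fun m => h m == k) (msupp f))) => [/hasP[m mf /eqP <-]|]; first by exists m.
rewrite -all_predC => /allP none; case/eqP: nz; apply: big1_seq => m /andP[hm mf].
by have := none m mf; rewrite /= hm.
Qed.

End Pushforward.

Lemma eq_pushm (K : fieldType) (V W : finType) (h k : {cmonom V} -> {cmonom W})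
    (f : {malg K[{cmonom V}]}) : h =1 k -> pushm h f = pushm k f.
Proof. by move=> E; rewrite !pushmE; apply: eq_bigr => m _; rewrite E. Qed.

Lemma pushm_comp (K : fieldType) (V W U : finType) (h : {cmonom V} -> {cmonom W})
    (g : {cmonom W} -> {cmonom U}) (f : {malg K[{cmonom V}]}) :
  pushm g (pushm h f) = pushm (g \o h) f.
Proof.
rewrite (pushmE h) (pushmE (g \o h)) /pushm raddf_sum; apply: eq_bigr => m _.
exact: pushm_scale_mono.
Qed.

Lemma psubst_pushm (K : fieldType) (V W : finType)
    (a : V -> {malg K[{cmonom W}]}) (h : {cmonom V} -> {cmonom W}) (f : {malg K[{cmonom V}]}) :
  (forall m : {cmonom V}, \prod_v a v ^+ m v = mono K (h m)) -> psubst a f = pushm h f.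
Proof.
by move=> E; rewrite /psubst /pushm !mmapE; apply: eq_bigr => m _; rewrite E.
Qed.

(** * Monomial ideals *)

Section MonomialIdeals.
Context (K : fieldType) (V : finType).
Local Notation R := {malg K[{cmonom V}]}.
Local Notation mono := (@mono K V).
Implicit Types (A : R -> Prop) (M : {cmonom V} -> Prop) (f : R).

Definition monomials M : R -> Prop := fun h => exists2 m, M m & h = mono m.

Lemma ideal_gen0 A : ideal_gen A 0.
Proof. by exists [::]; rewrite big_nil. Qed.

Lemma ideal_genD A f g : ideal_gen A f -> ideal_gen A g -> ideal_gen A (f + g).
Proof.
move=> [s [sA ->]] [t [tA ->]]; exists (s ++ t); rewrite big_cat; split=> // p.
by rewrite mem_cat => /orP[/sA|/tA].
Qed.

Lemma ideal_gen_mul A q f : A f -> ideal_gen A (q * f).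
Proof.
move=> Af; exists [:: (q, f)]; rewrite big_seq1; split=> // p.
by rewrite inE => /eqP ->.
Qed.

Lemma ideal_gen_sub A A' f :
  (forall q g, A g -> ideal_gen A' (q * g)) -> ideal_gen A f -> ideal_gen A' f.
Proof.
move=> sub [s [sA ->]]; elim: s sA => [|[q g] s IHs] sA.
  by rewrite big_nil; apply: ideal_gen0.
rewrite big_cons; apply: ideal_genD.
  by apply: sub; apply: (sA (q, g)); rewrite mem_head.
by apply: IHs => p ps; apply: sA; rewrite inE ps orbT.
Qed.

Lemma monomial_ideal_sub M M' f :
  (forall m, M m -> exists2 m', M' m' & cmdvd m' m) ->
  ideal_gen (monomials M) f -> ideal_gen (monomials M') f.
Proof.
move=> sub; apply: ideal_gen_sub => q g [m /sub[m' M'm' dvd] ->].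
rewrite (cmdvd_mulP dvd) monoM mulrA; apply: ideal_gen_mul.
by exists m'.
Qed.

(** Some summand, a multiple of a generator [mono m'], has [m] in its support, and every monomial of
    that support is a multiple of [m']. *)
Lemma monomial_ideal_dvd M m :
  ideal_gen (monomials M) (mono m) -> exists2 m', M m' & cmdvd m' m.
Proof.
move=> [s [sM E]].
have : m \in msupp (mono m) by rewrite supp_mono.
rewrite E -mcoeff_neq0 coef_sum => nz.
case: (boolP (has (fun p : R * R => m \in msupp (p.1 * p.2)) s)); last first.
  rewrite -all_predC => /allP none; case/eqP: nz; apply: big1_seq => p /none /=.
  exact: mcoeff_outdom.
case/hasP=> p ps; have [m' Mm' ->] := sM p ps.
move=> /msuppM_le[k1 [k2 [_]]]; rewrite supp_mono => /eqP -> ->.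
by exists m' => //; apply/cmdvdP => v; rewrite cmM leq_addl.
Qed.

End MonomialIdeals.

(** * Initial ideals of kernels of monomial maps *)

Section LeadingMonomials.
Context (K : fieldType) (V W : finType) (le : rel V).
Context (h : {cmonom V} -> {cmonom W}).
Local Notation R := {malg K[{cmonom V}]}.
Local Notation mono := (@mono K V).
Implicit Types (m : {cmonom V}) (f : R).

Definition nonminimal m : Prop := exists2 m', h m' = h m & revlex_lt le m' m.

Lemma lead_nonminimal f m :
  pushm h f = 0 -> is_lead (revlex le) f m -> nonminimal m.
Proof.
move=> f0 [mf mlead]; have [m' [m'f nm' E]] := pushm_kerP f0 mf.
by exists m' => //; have := mlead m' m'f; rewrite /revlex (negPf nm').
Qed.

Lemma binomial_lead m m' :
  revlex_lt le m' m -> is_lead (revlex le) (mono m - mono m') m.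
Proof.
move=> lt; have nm : m' != m by apply: contraTneq lt => ->; rewrite revlex_ltxx.
have supp k : k \in msupp (mono m - mono m') -> k = m \/ k = m'.
  rewrite -mcoeff_neq0 mcoeffB !coef_mono.
  case: (eqVneq m k) => [->|_]; first by left.
  by case: (eqVneq m' k) => [->|_]; [right|rewrite subr0 eqxx].
split; last by move=> k /supp[->|->]; rewrite /revlex ?eqxx // lt orbT.
by rewrite -mcoeff_neq0 mcoeffB !coef_mono eqxx (negPf nm) subr0 oner_eq0.
Qed.

Lemma lead_neq0 f m : is_lead (revlex le) f m -> f != 0.
Proof. by move=> [mf _]; apply: contraTneq mf => ->; rewrite msupp0 inE. Qed.

(** A leading monomial of a kernel element must cancel against a smaller one of its fibre;
    conversely, a nonminimal [m] leads the binomial [mono m - mono m'], which lies in the kernel. *)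
Lemma initial_ideal_monomials (I : R -> Prop) f : (forall g, I g <-> pushm h g = 0) ->
  initial_ideal (revlex le) I f <-> ideal_gen (monomials nonminimal) f.
Proof.
move=> IE; split; apply: ideal_gen_sub => q g.
  move=> [g' [m [/IE g'0 [leadm ->]]]]; rewrite monoE; apply: ideal_gen_mul.
  by exists m => //; apply: lead_nonminimal leadm.
move=> [m [m' E lt] ->]; apply: ideal_gen_mul; exists (mono m - mono m'), m.
by rewrite monoE; split; [apply/IE; rewrite pushm_binom|split=> //; apply: binomial_lead].
Qed.

End LeadingMonomials.

(** * Exponents of toric maps *)

Lemma big_option (A : Type) (idx : A) (op : Monoid.com_law idx) (I : finType)
    (F : option I -> A) :
  \big[op/idx]_(o : option I) F o = op (F None) (\big[op/idx]_(i : I) F (Some i)).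
Proof.
rewrite (bigD1 None) //=; congr (op _ _); rewrite (reindex_omap Some id) /=; last by case.
by apply: eq_bigl => j; rewrite eqxx.
Qed.

Lemma prod_monomials (A : comPzRingType) (I J : finType) (x : I -> A) (y : A)
    (b : J -> I -> nat) (c : J -> nat) :
  \prod_j (\prod_i x i ^+ b j i * y) ^+ c j =
  y ^+ (\sum_j c j) * \prod_i x i ^+ (\sum_j c j * b j i).
Proof.
under eq_bigr do rewrite exprMn -prodrXl mulrC.
rewrite big_split /= prodrXr exchange_big /=; congr (_ * _); apply: eq_bigr => i _.
by rewrite -prodrXr; apply: eq_bigr => j _; rewrite -exprM mulnC.
Qed.

Section ToricExponents.
Context (V : finType) (n : nat) (a : V -> 'rV[nat]_n).
Implicit Types (m : {cmonom V}).

(** The exponent vector of the image of [m] under [toric_map]. Each variable contributes one factor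
    s, so the exponent of s is the degree and fibres are homogeneous. *)
Definition toric_exp m : {cmonom option 'I_n} :=
  cmfun (fun o => if o is Some j then (\sum_v m v * a v ord0 j)%N else mdeg m).

Lemma toric_expP m m' : toric_exp m = toric_exp m' <->
  mdeg m = mdeg m' /\ forall j, (\sum_v m v * a v ord0 j = \sum_v m' v * a v ord0 j)%N.
Proof.
split=> [E|[Ed Es]].
  have {}E o : toric_exp m o = toric_exp m' o by rewrite E.
  by split=> [|j]; [have := E None|have := E (Some j)]; rewrite !cmfunE.
by apply: cm_ext => -[j|]; rewrite !cmfunE ?Es.
Qed.

Lemma toric_exp_mdeg m m' : toric_exp m = toric_exp m' -> mdeg m = mdeg m'.
Proof. by case/toric_expP. Qed.

Lemma toric_expM m m1 m2 :
  toric_exp m1 = toric_exp m2 -> toric_exp (m *' m1) = toric_exp (m *' m2).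
Proof.
case/toric_expP=> Ed Es; apply/toric_expP; split=> [|j]; first by rewrite !mdegM Ed.
under eq_bigr do rewrite cmM mulnDl; under [RHS]eq_bigr do rewrite cmM mulnDl.
by rewrite !big_split /= Es.
Qed.

(** The cofactor of [q] in [m] carries a smaller member of the fibre of [q] to a smaller member of
    the fibre of [m]. *)
Lemma nonminimal_dvd (le : rel V) q m :
  cmdvd q m -> nonminimal le toric_exp q -> nonminimal le toric_exp m.
Proof.
move=> /cmdvd_mulP -> [q' E lt]; exists (cmfun (fun v => m v - q v)%N *' q').
  exact: toric_expM.
by apply: revlex_ltM => //; apply: toric_exp_mdeg.
Qed.

Lemma toric_mapE (K : fieldType) (f : {malg K[{cmonom V}]}) :
  toric_map a f = pushm toric_exp f.
Proof.
apply: psubst_pushm => m; rewrite mono_prod.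
rewrite big_option (prod_monomials _ _ (fun v j => a v 0 j)).
rewrite cmfunE mdeg_sum; congr (_ * _).
by apply: eq_bigr => j _; rewrite cmfunE.
Qed.

End ToricExponents.

(** * Radicals of nonminimal monomials for the stable set polytope *)

Section StablePolytope.
Local Open Scope nat_scope.
Context (d : nat) (e : rel 'I_d).
Hypotheses (e_irrefl : irreflexive e) (e_perfect : perfect e).
Context (le : rel (stables e)).
Hypotheses (le_refl : reflexive le) (le_anti : antisymmetric le)
  (le_trans : transitive le) (le_total : total le).
(* Writing [{cmonom stables e}] would infer a choiceType instance that does not
   match, syntactically, the finType instances of the lemmas above. *)
Local Notation stablesF := (Specif_sig__canonical__fintype_Finite (stable_set e)).
Implicit Types (m r : {cmonom stablesF}) (v w : stables e) (C : {set 'I_d}).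

Local Notation stable_exp := (toric_exp (@stable_point d e)).

Definition stable_cover m j : nat := (\sum_w m w * (j \in val w))%N.

Lemma stable_expP m m' : stable_exp m = stable_exp m' <->
  mdeg m = mdeg m' /\ forall j, stable_cover m j = stable_cover m' j.
Proof.
have E m0 j : (\sum_v m0 v * @stable_point d e v ord0 j)%N = stable_cover m0 j.
  by apply: eq_bigr => v _; rewrite /stable_point mxE.
rewrite toric_expP; split=> -[-> Es]; split=> // j; first by rewrite -!E.
by rewrite !E.
Qed.

Lemma stable_coverM m m' j :
  stable_cover (m *' m') j = (stable_cover m j + stable_cover m' j)%N.
Proof.
by rewrite /stable_cover -big_split; apply: eq_bigr => w _; rewrite cmM mulnDl.
Qed.

Lemma stable_coverU v j : stable_cover (ucm v) j = (j \in val v).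
Proof.
rewrite /stable_cover (bigD1 v) //= cmUU mul1n big1 ?addn0 // => w nw.
by rewrite cmU eq_sym (negPf nw).
Qed.

Lemma sum_count_stable (F : {set 'I_d} -> nat) s : all (stable_set e) s ->
  (\sum_(w : stables e) count_mem (val w) s * F (val w) = \sum_(T <- s) F T)%N.
Proof.
elim: s => [_|T s IHs /= /andP[stT sts]]; first by rewrite big_nil big1.
rewrite big_cons -IHs // (bigD1 (exist _ T stT : stables e)) //=.
rewrite [in RHS](bigD1 (exist _ T stT : stables e)) //= eqxx mulnDl mul1n -!addnA.
congr (_ + (_ + _))%N; apply: eq_bigr => w /negPf nw.
have -> // : (T == val w) = false.
by rewrite eq_sym -nw -val_eqE.
Qed.

(** The integer decomposition property of the stable set polytope: the list of stable sets from the
    weighted colouring is read as a monomial by counting multiplicities. *)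
Lemma stable_decomposition (p : 'I_d -> nat) k :
  (forall C, clique e C -> \sum_(j in C) p j <= k)%N ->
  exists2 m, mdeg m = k & forall j, stable_cover m j = p j.
Proof.
move=> /(perfect_weighted_colouring e_irrefl e_perfect)[s [<- sts pE]].
exists (cmfun (fun w => count_mem (val w) s)) => [|j].
  rewrite mdeg_sum -sum1_size -(sum_count_stable (fun _ => 1%N) sts).
  by apply: eq_bigr => w _; rewrite cmfunE muln1.
rewrite pE -(sum_count_stable (fun T => (j \in T) : nat) sts).
by apply: eq_bigr => w _; rewrite cmfunE.
Qed.

Definition cmrad (V : finType) (m : {cmonom V}) : {cmonom V} :=
  cmfun (fun u => (0 < m u)%N : nat).

(** A stable set meets a clique at most once, so [1 - #|C :&: val w|] is not truncated; it is the
    slack of the clique inequality at the vertex [w]. *)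
Lemma clique_slack m C : clique e C ->
  (\sum_w m w * (1 - #|C :&: val w|) + \sum_(j in C) stable_cover m j = mdeg m)%N.
Proof.
move=> clC; rewrite /stable_cover exchange_big /= -big_split mdeg_sum /=.
apply: eq_bigr => w _; rewrite -big_distrr /= sum_nat_mem -mulnDr subnK ?muln1 //.
exact: clique_stable_card clC (valP w).
Qed.

(* The facet functionals of the stable set polytope (coordinates and clique
   slacks) take only the values 0 and 1 on stable sets, so whether the
   smallest variable v can be split off from the variables above it depends on
   the support alone. *)
Lemma nonminimal_cmrad m :
  nonminimal le stable_exp m -> nonminimal le stable_exp (cmrad m).
Proof.
case=> m' /stable_expP[Ed Ec] /(revlex_ltP _ Ed)[v lt_v eq_v].
(* [v] is the smallest variable where the exponents differ, and it is larger in [m']; [up] selects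
   the variables strictly above [v]. *)
pose up w := ~~ le w v.
(* [m'] has more of [v] and agrees with [m] below it, so equal totals of [F] force a variable above
   [v] in [m] on which [F] is positive. *)
have witness (F : stables e -> nat) : (\sum_w m' w * F w = \sum_w m w * F w)%N ->
    (0 < F v)%N -> exists w, [/\ up w, 0 < m w & 0 < F w]%N.
  move=> EF Fv; case: (boolP [exists w, [&& up w, 0 < m w & 0 < F w]%N]).
    by move=> /existsP[w /and3P[]]; exists w.
  rewrite negb_exists => /forallP none; exfalso.
  have : (\sum_w m w * F w < \sum_w m' w * F w)%N.
    rewrite (bigD1 v) //= [X in (_ < X)%N](bigD1 v) //= -addSn leq_add //.
      by rewrite ltn_pmul2r.
    apply: leq_sum => w nw; case: (boolP (up w)) => [upw|]; last first.
      by rewrite negbK => lwv; rewrite eq_v.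
    have := none w; rewrite upw /= negb_and -!leqNgt !leqn0.
    by case/orP=> /eqP ->; rewrite ?muln0.
  by rewrite EF ltnn.
have mem_witness j : j \in val v -> exists w, [/\ up w, 0 < m w & j \in val w]%N.
  move=> jv; have [||w [upw mw jw]] := witness (fun w => (j \in val w) : nat).
  - exact: Ec.
  - by rewrite jv.
  - by exists w; split=> //; case: (j \in val w) jw.
have clique_witness C : clique e C -> #|C :&: val v| = 0%N ->
    exists w, [/\ up w, 0 < m w & #|C :&: val w| = 0]%N.
  move=> clC Cv; have [||w [upw mw Cw]] := witness (fun w => 1 - #|C :&: val w|)%N.
  - have := clique_slack m clC; have := clique_slack m' clC.
    by rewrite Ed (eq_bigr _ (fun j _ => Ec j)) => <- /eqP; rewrite eqn_add2r => /eqP ->.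
  - by rewrite Cv.
  - by exists w; split=> //; lia.
(* [r] is the part of [cmrad m] above [v]; only this part will be replaced. *)
pose r := cmfun (fun w => (up w && (0 < m w))%N : nat).
have r_gt0 w : up w -> (0 < m w)%N -> r w = 1%N by move=> upw mw; rewrite cmfunE upw mw.
pose rest := cmfun (fun w => (~~ up w && (0 < m w))%N : nat).
have radE : cmrad m = rest *' r.
  by apply: cm_ext => w; rewrite cmM !cmfunE; case: (up w); case: (0 < m w)%N.
have rv : r v = 0%N by rewrite cmfunE /up le_refl.
have cover_r j : ((j \in val v) <= stable_cover r j)%N.
  case: (boolP (j \in val v)) => // /mem_witness[w [upw mw jw]].
  by rewrite /stable_cover (bigD1 w) //= r_gt0 // jw.
have slack_r C : clique e C -> #|C :&: val v| = 0%N ->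
    (0 < \sum_w r w * (1 - #|C :&: val w|))%N.
  move=> clC /(clique_witness C clC)[w [upw mw Cw]].
  by rewrite (bigD1 w) //= r_gt0 // Cw.
(* Taking [v] away from the cover of [r] respects the clique bounds for one set fewer: a clique
   meeting [v] loses weight one, and any other clique has positive slack. *)
have [t0 t0d t0c] : exists2 t0, mdeg t0 = (mdeg r).-1 &
    forall j, stable_cover t0 j = (stable_cover r j - (j \in val v))%N.
  apply: stable_decomposition => C clC; have := clique_slack r clC.
  have -> : (\sum_(j in C) stable_cover r j =
      \sum_(j in C) (stable_cover r j - (j \in val v)) + #|C :&: val v|)%N.
    by rewrite -sum_nat_mem -big_split; apply: eq_bigr => j _; rewrite /= subnK.
  have := slack_r C clC; case: (#|C :&: val v|) => [/(_ (erefl _)) + <-|n _ <-].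
    by case: (\sum_w _)%N => // x _; rewrite addSn /= addn0 leq_addl.
  by rewrite !addnS /=; apply: leq_trans (leq_addl _ _); apply: leq_addr.
(* For the empty clique the slack is the degree itself. *)
have rd : (0 < mdeg r)%N.
  have cl0 : clique e set0 by apply/forall_inP => i; rewrite inE.
  have := slack_r set0 cl0; rewrite set0I cards0 => /(_ (erefl _)).
  by rewrite -(clique_slack r cl0) addn_gt0 => ->.
pose t := ucm v *' t0.
have td : mdeg t = mdeg r by rewrite mdegM mdegU t0d add1n prednK.
exists (rest *' t); rewrite radE.
  apply: toric_expM; apply/stable_expP; split=> // j.
  by rewrite stable_coverM stable_coverU t0c subnKC.
apply: revlex_ltM => //.
(* If instead [r] were smaller than [t], the deciding variable would occur in [r], hence lie above
   [v]; but [r] and [t] already differ at [v]. *)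
have ntr : t != r by apply/eqP=> E; move: rv; rewrite -E cmM cmUU.
have [//|] := orP (revlex_lt_total le_refl le_anti le_trans td ntr).
case/(revlex_ltP _ (esym td)) => u ltu equ; have upu : up u.
  by move: ltu; rewrite [r u]cmfunE; case: (up u).
have lvu : le v u by have := le_total u v; rewrite (negPf upu).
have nvu : v != u by apply: contraNneq upu => ->; rewrite le_refl.
by have := equ v nvu lvu; rewrite rv cmM cmUU.
Qed.

End StablePolytope.

(** * Fibres of the Cayley sum *)

Section CayleyFibres.
Local Open Scope nat_scope.
Context (d : nat) (leP e : rel 'I_d).
Hypotheses (leP_anti : antisymmetric leP) (leP_trans : transitive leP).
Local Notation stablesF := (Specif_sig__canonical__fintype_Finite (stable_set e)).
Local Notation cvarF := (Datatypes_sum__canonical__fintype_Finite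
  (Specif_sig__canonical__fintype_Finite (poset_ideal leP)) stablesF).
Implicit Types (m : {cmonom cvarF}) (u : {cmonom stablesF}).
Implicit Types (I : ideals leP) (S : stables e) (j k : 'I_d).

Local Notation cayley_exp := (toric_exp (@cayley_point d leP e)).
Local Notation xv I := (inl I : cvar leP e).
Local Notation yv S := (inr S : cvar leP e).

Definition ypart m : {cmonom stablesF} := cmfun (fun S => m (yv S)).

Definition yembed u : {cmonom cvarF} :=
  cmfun (fun v : cvar leP e => if v is inr w then u w else 0%N).

(** The exponent of the last t-variable in the image of [m]; [xcover m j] is the share of the
    x-variables in the exponent of the t-variable of [j]. *)
Definition xcount m : nat := (\sum_I m (xv I))%N.

Definition xcover m j : nat := (\sum_I m (xv I) * (j \in val I))%N.

Lemma yembed_inj : injective yembed.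
Proof.
move=> u u' E; apply: cm_ext => S; have : yembed u (yv S) = yembed u' (yv S) by rewrite E.
by rewrite !cmfunE.
Qed.

Lemma ypart_yembed u : ypart (yembed u) = u.
Proof. by apply: cm_ext => S; rewrite !cmfunE. Qed.

Lemma sum_cvar (F : cvar leP e -> nat) :
  (\sum_v F v = \sum_I F (xv I) + \sum_S F (yv S))%N.
Proof. by rewrite big_sumType. Qed.

Lemma mdeg_cvar m : mdeg m = (xcount m + mdeg (ypart m))%N.
Proof.
rewrite !mdeg_sum sum_cvar; congr addn.
by apply: eq_bigr => S _; rewrite cmfunE.
Qed.

Lemma cayley_exp_lshift m j :
  cayley_exp m (Some (lshift 1 j)) = (xcover m j + stable_cover (ypart m) j)%N.
Proof.
rewrite cmfunE sum_cvar; congr addn; apply: eq_bigr => v _; first by rewrite row_mxEl mxE.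
by rewrite row_mxEl mxE cmfunE.
Qed.

Lemma cayley_exp_rshift m (j : 'I_1) : cayley_exp m (Some (rshift d j)) = xcount m.
Proof.
rewrite cmfunE sum_cvar [X in (_ + X)%N]big1 => [|v _]; last by rewrite row_mxEr mxE muln0.
by rewrite addn0; apply: eq_bigr => v _; rewrite row_mxEr mxE muln1.
Qed.

Lemma cayley_expP m m' : cayley_exp m = cayley_exp m' <->
  [/\ mdeg m = mdeg m', xcount m = xcount m'
    & forall j, (xcover m j + stable_cover (ypart m) j =
                 xcover m' j + stable_cover (ypart m') j)%N].
Proof.
split=> [E|[Ed Ex Ec]].
  split=> [||j]; first exact: toric_exp_mdeg E.
    by rewrite -!(cayley_exp_rshift _ ord0) E.
  by rewrite -!cayley_exp_lshift E.
apply: cm_ext => -[j|]; last by rewrite !cmfunE.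
case: (split_ordP j) => i ->; first by rewrite !cayley_exp_lshift Ec.
by rewrite !cayley_exp_rshift Ex.
Qed.

(** Without x-variables the last t-exponent is zero and the others are those of the stable set
    polytope, so [yembed] maps fibres into fibres. *)
Lemma cayley_exp_yembed :
  exists lift : {cmonom option 'I_d} -> {cmonom option 'I_(d + 1)}, forall u,
  cayley_exp (yembed u) = lift (toric_exp (@stable_point d e) u).
Proof.
exists (fun c => cmfun (fun o => if o is Some j then
  if split j is inl i then c (Some i) else 0%N else c None)) => u.
apply: cm_ext => o; rewrite [RHS]cmfunE; case: o => [j|].
  case: (split_ordP j) => i ->.
    rewrite cayley_exp_lshift ypart_yembed /xcover big1 ?add0n => [|I _]; last by rewrite cmfunE.
    by rewrite cmfunE; apply: eq_bigr => v _; rewrite mxE.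
  rewrite cayley_exp_rshift /xcount big1 // => I _.
  by rewrite cmfunE.
rewrite !cmfunE mdeg_cvar ypart_yembed /xcount big1 // => I _.
by rewrite cmfunE.
Qed.

(** This and [unmixed] express that no leading term of a poset binomial, respectively of a mixed
    binomial, divides [m]. *)
Definition xchain m : Prop := forall I I', (0 < m (xv I))%N -> (0 < m (xv I'))%N ->
  (val I \subset val I') || (val I' \subset val I).

Definition unmixed m : Prop := forall I S j, (0 < m (xv I))%N -> (0 < m (yv S))%N ->
  j \in val S :\: val I -> ~~ poset_ideal leP (j |: val I).

Lemma ideal_down I k j : leP k j -> j \in val I -> k \in val I.
Proof.
move=> lkj jI; have /forall_inP/(_ j jI)/forallP/(_ k)/implyP := valP I.
exact.
Qed.

Lemma xcover_anti m k j : leP k j -> (xcover m j <= xcover m k)%N.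
Proof.
move=> lkj; apply: leq_sum => I _; rewrite leq_mul2l; apply/orP; right.
by case: (boolP (j \in val I)) => // /(ideal_down lkj) ->.
Qed.

Lemma xcover_count m j : (xcover m j <= xcount m)%N.
Proof.
by apply: leq_sum => I _; rewrite -[leqRHS]muln1 leq_mul2l leq_b1 orbT.
Qed.

(* If the x-part of [m] covered j less often than that of [m'], some y_S with
   j in S and some x_I with j not in I occur in [m]; for I maximal, [unmixed]
   provides k < j outside I, and k is covered no more often than j. *)
Lemma xcover_ge m m' j : xchain m -> unmixed m -> xcount m = xcount m' ->
  (xcover m j + stable_cover (ypart m) j = xcover m' j + stable_cover (ypart m') j)%N ->
  (forall k, leP k j -> k != j -> xcover m k = xcover m' k) ->
  (xcover m' j <= xcover m j)%N.
Proof.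
move=> chm unm Ex Ej IH; rewrite leqNgt; apply/negP=> ltj.
(* [j] is covered in [m] fewer than [xcount m] times. *)
have [I0 I0P] : exists I, (0 < m (xv I))%N && (j \notin val I).
  apply/existsP; apply: contraLR (leq_trans ltj (xcover_count _ _)).
  rewrite negb_exists -Ex -leqNgt => /forallP none; apply: leq_sum => I _.
  have := none I; rewrite negb_and negbK -leqNgt leqn0.
  by case/orP=> [/eqP ->//|->]; rewrite muln1.
case: (@arg_maxnP _ I0 (fun I => (0 < m (xv I))%N && (j \notin val I)) (fun I => #|val I|) I0P).
move=> I /andP[mI jI] maxI.
have [S /andP[mS jS]] : exists S, (0 < m (yv S))%N && (j \in val S).
  apply/existsP; have : (0 < stable_cover (ypart m) j)%N by lia.
  apply: contraLR; rewrite negb_exists -leqNgt leqn0 => /forallP none.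
  rewrite /stable_cover big1 // => S _; rewrite cmfunE.
  have := none S; rewrite negb_and -leqNgt leqn0.
  by case/orP=> [/eqP ->//|/negPf ->]; rewrite muln0.
have := unm I S j mI mS; rewrite inE jI jS => /(_ isT).
rewrite negb_forall => /existsP[i]; rewrite negb_imply => /andP[iI].
rewrite negb_forall => /existsP[k]; rewrite negb_imply !inE negb_or => /and3P[lki nkj kI].
have Eij : i = j.
  by move: iI; rewrite !inE => /orP[/eqP //|/(ideal_down lki)]; rewrite (negPf kI).
rewrite {}Eij {i iI} in lki.
(* An ideal occurring in [m] with [k] but not [j] would lie inside [I], by the chain condition and
   the maximality of [I]; yet [k] is not in [I]. *)
suff lekj : (xcover m k <= xcover m j)%N.
  have := xcover_anti m' lki; have := IH k lki nkj; lia.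
apply: leq_sum => I' _; case: (posnP (m (xv I'))) => [->//|mI'].
rewrite leq_mul2l; apply/orP; right; case: (boolP (k \in val I')) => // kI'.
case: (boolP (j \in val I')) => // jI'; have sI'I : val I' \subset val I.
  case/orP: (chm I I' mI mI') => // sII'; have := maxI I'; rewrite mI' jI' => /(_ isT) le.
  by have /eqP <- : val I == val I' by rewrite eqEcard sII'; exact: le.
by rewrite (subsetP sI'I) in kI.
Qed.

(** For nonempty [T], the ideals of a chain that contain [T] are those that contain its least
    covered element, so their number is a value of [xcover]; for [m'] that value is an upper
    bound. *)
Lemma up_sum_ge m m' (T : {set 'I_d}) : xchain m -> xcount m = xcount m' ->
  (forall j, xcover m j = xcover m' j) ->
  (\sum_(I : ideals leP | T \subset val I) m' (xv I) <=
   \sum_(I : ideals leP | T \subset val I) m (xv I))%N.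
Proof.
move=> chm Ex Ec; case: (set_0Vmem T) => [->|[j0 j0T]].
  rewrite (eq_bigl xpredT) => [|I]; last by rewrite sub0set.
  rewrite [leqRHS](eq_bigl xpredT) => [|I]; last by rewrite sub0set.
  by rewrite -/(xcount m) -/(xcount m') Ex.
case: (@arg_minnP _ j0 (fun j => j \in T) (xcover m) j0T) => j jT minj.
have coverT m0 : (\sum_(I : ideals leP | T \subset val I) m0 (xv I) <= xcover m0 j)%N.
  rewrite big_mkcond; apply: leq_sum => I _; case: ifP => // /subsetP sTI.
  by rewrite sTI // muln1.
apply: leq_trans (coverT m') _; rewrite -Ec [leqRHS]big_mkcond; apply: leq_sum => I _.
case: (boolP (j \in val I)) => jI; rewrite ?muln0 // muln1.
case: (posnP (m (xv I))) => [->//|mI]; case: ifP => // /negP[].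
(* If [I] misses [k], every occurring ideal with [k] contains [I], hence [j]; then [k] is covered
   strictly less often than [j]. *)
apply/subsetP => k kT; apply: contraT => kI.
have : (xcover m k < xcover m j)%N; last by rewrite ltnNge minj.
rewrite /xcover (bigD1 I) //= [X in (_ < X)%N](bigD1 I) //= jI (negPf kI).
rewrite muln0 muln1 add0n -add1n leq_add //; apply: leq_sum => I' _.
case: (posnP (m (xv I'))) => [->//|mI']; rewrite leq_mul2l; apply/orP; right.
case: (boolP (k \in val I')) => // kI'; have [sII'|sI'I] := orP (chm I I' mI mI').
  by rewrite (subsetP sII').
by rewrite (subsetP sI'I) in kI.
Qed.

(** The sums over all ideals containing [I] agree, so the multiplicity of [I] follows from those of
    the strictly larger ideals, from the top down. *)
Lemma xchain_unique m m' : xchain m -> xchain m' -> xcount m = xcount m' ->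
  (forall j, xcover m j = xcover m' j) -> forall I, m (xv I) = m' (xv I).
Proof.
move=> chm chm' Ex Ec.
have Eup (T : {set 'I_d}) :
    (\sum_(I : ideals leP | T \subset val I) m (xv I) =
     \sum_(I : ideals leP | T \subset val I) m' (xv I))%N.
  by apply/eqP; rewrite eqn_leq !up_sum_ge.
move=> I; have [n] := ubnP #|~: val I|; elim: n I => // n IHn I ltn.
have := Eup (val I); rewrite (bigD1 I) //= [RHS](bigD1 I) //=.
rewrite (eq_bigr (fun I' => m' (xv I'))) => [/addIn //|I' /andP[sII' nI]].
apply: IHn; rewrite -ltnS; apply: leq_ltn_trans ltn; apply: proper_card.
by rewrite properC properEneq sII' andbT eq_sym val_eqE.
Qed.

Lemma straight_unique m m' : cayley_exp m = cayley_exp m' ->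
  xchain m -> unmixed m -> xchain m' -> unmixed m' ->
  (forall I, m (xv I) = m' (xv I)) /\
  toric_exp (@stable_point d e) (ypart m) = toric_exp (@stable_point d e) (ypart m').
Proof.
move=> /cayley_expP[Ed Ex Ec] chm unm chm' unm'.
have Exc j : xcover m j = xcover m' j.
  (* Induction on the number of elements strictly below [j]; [xcover_ge] then applies in both
     directions. *)
  have [n] := ubnP #|[set k | leP k j && (k != j)]|; elim: n j => // n IHn j ltn.
  have IH k : leP k j -> k != j -> xcover m k = xcover m' k.
    move=> lkj nkj; apply: IHn; rewrite -ltnS; apply: leq_ltn_trans ltn.
    apply/proper_card/properP; split.
      apply/subsetP => i; rewrite !inE => /andP[lik nik].
      rewrite (leP_trans lik lkj); apply: contraNneq nik => Eij.
      by rewrite Eij in lik *; apply/eqP/leP_anti; rewrite lkj lik.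
    by exists k; rewrite !inE ?lkj // eqxx andbF.
  apply/eqP; rewrite eqn_leq (xcover_ge chm' unm' (esym Ex) (esym (Ec j))) /=; last first.
    by move=> k lkj nkj; rewrite IH.
  exact: (xcover_ge chm unm Ex (Ec j)).
split; first exact: xchain_unique.
apply/stable_expP; split=> [|j]; first by move: Ed; rewrite !mdeg_cvar Ex; lia.
by have := Ec j; rewrite Exc; lia.
Qed.

End CayleyFibres.

(** * Quadratic monomials *)

Section Pairs.
Context (V : finType).
Implicit Types (m : {cmonom V}) (v w : V).

Definition cmpair a b : {cmonom V} := cmfun (fun v => (a == v) + (b == v))%N.

Lemma mdeg_pair a b : mdeg (cmpair a b) = 2%N.
Proof.
rewrite mdeg_sum (eq_bigr (fun v => (a == v) + (b == v))%N) => [|v _]; last by rewrite cmfunE.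
have sum1 c : (\sum_v (c == v) = 1)%N.
  by rewrite (bigD1 c) //= eqxx big1 // => v; rewrite eq_sym => /negPf ->.
by rewrite big_split /= !sum1.
Qed.

Lemma mono_pair (K : fieldType) a b : mono K (cmpair a b) = pvar K a * pvar K b.
Proof.
rewrite !pvarE -monoM; congr mono; apply: cm_ext => v.
by rewrite cmM !cmU cmfunE.
Qed.

(** [v] lies strictly below [a] and [b], and [c] does not lie below [v], so [v] is the smallest
    variable with different exponents. *)
Lemma revlex_lt_pair (le : rel V) v a b c : antisymmetric le ->
  (v != a) && le v a -> (v != b) && le v b -> le v c ->
  revlex_lt le (cmpair c v) (cmpair a b).
Proof.
move=> le_anti /andP[nva lva] /andP[nvb lvb] lvc.
apply/revlex_ltP; first by rewrite !mdeg_pair.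
exists v.
  by rewrite !cmfunE [a == v]eq_sym [b == v]eq_sym (negPf nva) (negPf nvb) eqxx addn1.
have neq_above w u : w != v -> le w v -> le v u -> (u == w) = false.
  by move=> nwv lwv lvu; apply: contraNF nwv => /eqP Eu; apply/eqP/le_anti; rewrite lwv -Eu.
move=> w nwv lwv; rewrite !cmfunE [v == w]eq_sym (negPf nwv).
by rewrite (neq_above _ a nwv lwv lva) (neq_above _ b nwv lwv lvb) (neq_above _ c nwv lwv lvc).
Qed.

Lemma cmdvd_pair a b m : a != b -> (0 < m a)%N -> (0 < m b)%N -> cmdvd (cmpair a b) m.
Proof.
move=> nab ma mb; apply/cmdvdP => v; rewrite cmfunE.
by case: eqP => [<-|_]; [rewrite eq_sym (negPf nab)|case: eqP => [<-|]].
Qed.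

Lemma cmsquarefree_pair a b : a != b -> cmsquarefree (cmpair a b).
Proof.
move=> nab; apply/forallP => v; rewrite cmfunE.
by case: eqP => [<-|_]; [rewrite eq_sym (negPf nab)|case: eqP].
Qed.

End Pairs.

(** * Nonminimal monomials of the Cayley sum *)

Section CayleyInitial.
Context (d : nat) (leP e : rel 'I_d).
Hypotheses (leP_anti : antisymmetric leP) (leP_trans : transitive leP).
Context (lev : rel (cvar leP e)) (lev_adm : admissible_order lev).
Local Notation stablesF := (Specif_sig__canonical__fintype_Finite (stable_set e)).
Local Notation cvarF := (Datatypes_sum__canonical__fintype_Finite
  (Specif_sig__canonical__fintype_Finite (poset_ideal leP)) stablesF).
Implicit Types (m q : {cmonom cvarF}) (u : {cmonom stablesF}).
Implicit Types (I : ideals leP) (S : stables e) (j k : 'I_d).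

Local Notation cayley_exp := (toric_exp (@cayley_point d leP e)).
Local Notation stable_exp := (toric_exp (@stable_point d e)).
Local Notation yle := (yz_order lev).
Local Notation xv I := (inl I : cvar leP e).
Local Notation yv S := (inr S : cvar leP e).

Lemma adm_refl : reflexive lev. Proof. by case: lev_adm => -[]. Qed.
Lemma adm_anti : antisymmetric lev. Proof. by case: lev_adm => -[]. Qed.
Lemma adm_trans : transitive lev. Proof. by case: lev_adm => -[]. Qed.
Lemma adm_total : total lev. Proof. by case: lev_adm => -[]. Qed.
Lemma yz_refl : reflexive yle. Proof. by move=> S; apply: adm_refl. Qed.
Lemma yz_anti : antisymmetric yle. Proof. by move=> S S' /adm_anti[]. Qed.
Lemma yz_trans : transitive yle. Proof. by move=> S S' S''; apply: adm_trans. Qed.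
Lemma yz_total : total yle. Proof. by move=> S S'; apply: adm_total. Qed.

Lemma revlex_lt_yembed u u' : revlex_lt yle u' u -> revlex_lt lev (yembed leP u') (yembed leP u).
Proof.
have dE u0 : mdeg (yembed leP u0) = mdeg u0.
  by rewrite mdeg_cvar ypart_yembed /xcount big1 // => I _; rewrite cmfunE.
move=> lt; move: (revlex_lt_mdeg lt); rewrite leq_eqVlt => /orP[/eqP E|ltd]; last first.
  by rewrite /revlex_lt !dE ltd.
case/(revlex_ltP _ E): lt => S ltS eqS; apply/revlex_ltP; first by rewrite !dE.
exists (yv S); first by rewrite !cmfunE.
by case=> [I|S'] nS lS; rewrite !cmfunE //; apply: eqS.
Qed.

Lemma nonminimal_yembed u :
  nonminimal yle stable_exp u -> nonminimal lev cayley_exp (yembed leP u).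
Proof.
case=> u' E lt; have [lift liftE] := cayley_exp_yembed leP e.
by exists (yembed leP u'); [rewrite !liftE E|apply: revlex_lt_yembed].
Qed.

Lemma yembed_dvd u m : cmdvd u (ypart m) -> cmdvd (yembed leP u) m.
Proof.
move=> /cmdvdP dvd; apply/cmdvdP => -[I|S]; rewrite cmfunE //.
by have := dvd S; rewrite cmfunE.
Qed.

(** [q] and [q'] are the leading and the trailing monomial of a poset binomial; [mixed_swap] does
    the same for mixed binomials. *)
Definition poset_swap q q' : Prop := exists I1 I2 I3 I4,
  [/\ ~~ (val I1 \subset val I2) && ~~ (val I2 \subset val I1),
      val I3 = val I1 :&: val I2, val I4 = val I1 :|: val I2,
      q = cmpair (xv I1) (xv I2) & q' = cmpair (xv I3) (xv I4)].

Definition mixed_swap q q' : Prop := exists I S I' S' j,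
  [/\ j \in val S :\: val I, val I' = j |: val I, val S' = val S :\ j,
      q = cmpair (xv I) (yv S) & q' = cmpair (xv I') (yv S')].

(** [is_inl] and [points] encode the Cayley point of a variable: its last coordinate and the support
    of the others. *)
Definition is_inl (v : cvar leP e) : bool := if v is inl _ then true else false.

Definition points (v : cvar leP e) : {set 'I_d} :=
  match v with inl x => val x | inr w => val w end.

Lemma sum_xv (F : ideals leP -> nat) (v : cvar leP e) :
  (\sum_I (v == xv I) * F I = if v is inl x then F x else 0)%N.
Proof.
case: v => [I|w]; last by rewrite big1.
rewrite (bigD1 I) //= eqxx mul1n big1 ?addn0 // => I' nI.
by rewrite (inj_eq inl_inj) eq_sym (negPf nI).
Qed.

Lemma sum_yv (F : stables e -> nat) (v : cvar leP e) :
  (\sum_S (v == yv S) * F S = if v is inr w then F w else 0)%N.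
Proof.
case: v => [I|w]; first by rewrite big1.
rewrite (bigD1 w) //= eqxx mul1n big1 ?addn0 // => w' nw.
by rewrite (inj_eq inr_inj) eq_sym (negPf nw).
Qed.

Lemma xcount_pair (v w : cvar leP e) : xcount (cmpair v w) = (is_inl v + is_inl w)%N.
Proof.
rewrite /xcount (eq_bigr (fun I => (v == xv I) * 1 + (w == xv I) * 1)%N) => [|I _].
  by rewrite big_split /= !sum_xv; case: v; case: w.
by rewrite cmfunE !muln1.
Qed.

Lemma cover_pair (v w : cvar leP e) j :
  (xcover (cmpair v w) j + stable_cover (ypart (cmpair v w)) j =
   (j \in points v) + (j \in points w))%N.
Proof.
rewrite /xcover (eq_bigr (fun I => (v == xv I) * (j \in val I) + (w == xv I) * (j \in val I))%N).
  rewrite /stable_cover.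
  rewrite (eq_bigr (fun S => (v == yv S) * (j \in val S) + (w == yv S) * (j \in val S))%N).
    rewrite !big_split /= !sum_xv !sum_yv.
    by case: v => v; case: w => w; rewrite ?addn0 ?add0n // addnC.
  by move=> S _; rewrite !cmfunE mulnDl.
by move=> I _; rewrite cmfunE mulnDl.
Qed.

Lemma cayley_exp_pair (v w v' w' : cvar leP e) :
  (is_inl v + is_inl w = is_inl v' + is_inl w')%N ->
  (forall j, (j \in points v) + (j \in points w) = (j \in points v') + (j \in points w'))%N ->
  cayley_exp (cmpair v w) = cayley_exp (cmpair v' w').
Proof.
move=> Ex Ec; apply/cayley_expP; split=> [||j].
- exact: etrans (mdeg_pair _ _) (esym (mdeg_pair _ _)).
- exact: etrans (xcount_pair _ _) (etrans Ex (esym (xcount_pair _ _))).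
- exact: etrans (cover_pair _ _ _) (etrans (Ec j) (esym (cover_pair _ _ _))).
Qed.

(** Larger ideals have smaller variables, so the variable of the union is the smallest of the
    four. *)
Lemma poset_swapP q q' : poset_swap q q' ->
  [/\ cayley_exp q = cayley_exp q', revlex_lt lev q' q & cmsquarefree q].
Proof.
case: lev_adm => _ [_ ltx _].
case=> [I1 [I2 [I3 [I4 [/andP[n12 n21] E3 E4 -> ->]]]]]; split.
- apply: cayley_exp_pair => //= j; rewrite E3 E4 !inE.
  by case: (j \in val I1); case: (j \in val I2).
- apply: revlex_lt_pair; first exact: adm_anti.
  + by apply: ltx; rewrite E4 properE subsetUl subUset subxx.
  + by apply: ltx; rewrite E4 properE subsetUr subUset subxx andbT.
  + suff /andP[] : (xv I4 != xv I3) && lev (xv I4) (xv I3) by [].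
    apply: ltx; rewrite E4 E3 properE subIset ?subsetUl //= subUset.
    by apply/negP => /andP[]; rewrite subsetI subxx /= (negPf n12).
- apply: cmsquarefree_pair; rewrite (inj_eq inl_inj).
  by apply: contraNneq n12 => ->.
Qed.

Lemma mixed_swapP q q' : mixed_swap q q' ->
  [/\ cayley_exp q = cayley_exp q', revlex_lt lev q' q & cmsquarefree q].
Proof.
case: lev_adm => _ [ltzyx _ lty].
case=> [I [S [I' [S' [j [/setDP[jS jI] EI ES -> ->]]]]]]; split.
- apply: cayley_exp_pair => //= i; rewrite EI ES !inE; case: (eqVneq i j) => [->|_] //=.
  by rewrite (negPf jI) jS.
- have S0 : val S != set0 by apply/set0Pn; exists j.
  have ltS : (yv S' != yv S) && lev (yv S') (yv S).
    (* The order condition between stable sets asks for a nonempty smaller set; the empty one gives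
       z, which has its own condition. *)
    case: (eqVneq (val S') set0) => [E0|n0].
      have -> : S' = zind e by apply: val_inj.
      by have /andP[] := ltzyx S I S0.
    by apply: lty => //; rewrite ES properD1.
  have ltx I0 : (yv S' != xv I0) && lev (yv S') (xv I0).
    have /andP[_ /andP[_ lSI]] := ltzyx S I0 S0; have /andP[_ lS'S] := ltS.
    by rewrite /= (adm_trans lS'S).
  by apply: revlex_lt_pair => //; [exact: adm_anti|have /andP[] := ltx I'].
exact: cmsquarefree_pair.
Qed.

Lemma poset_idealI I I' : poset_ideal leP (val I :&: val I').
Proof.
apply/forall_inP => j; rewrite inE => /andP[jI jI']; apply/forallP => i.
by apply/implyP => lij; rewrite inE (ideal_down lij jI) (ideal_down lij jI').
Qed.

Lemma poset_idealU I I' : poset_ideal leP (val I :|: val I').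
Proof.
apply/forall_inP => j; rewrite inE => jII; apply/forallP => i; apply/implyP => lij.
by rewrite inE; case/orP: jII => /(ideal_down lij) ->; rewrite ?orbT.
Qed.

Lemma xchain_or_swap m : xchain m \/ exists q q', poset_swap q q' /\ cmdvd q m.
Proof.
case: (boolP [exists I1, exists I2, [&& (0 < m (xv I1))%N, (0 < m (xv I2))%N,
    ~~ (val I1 \subset val I2) & ~~ (val I2 \subset val I1)]]).
  move=> /existsP[I1 /existsP[I2 /and4P[m1 m2 n12 n21]]]; right.
  pose I3 : ideals leP := exist (poset_ideal leP) _ (poset_idealI I1 I2).
  pose I4 : ideals leP := exist (poset_ideal leP) _ (poset_idealU I1 I2).
  exists (cmpair (xv I1) (xv I2)), (cmpair (xv I3) (xv I4)).
  split.
    by exists I1, I2, I3, I4; split=> //; apply/andP.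
  apply: cmdvd_pair => //; rewrite (inj_eq inl_inj).
  by apply: contraNneq n12 => ->.
rewrite negb_exists => /forallP none; left => I1 I2 m1 m2.
have := none I1; rewrite negb_exists => /forallP/(_ I2).
by rewrite m1 m2 /= negb_and !negbK.
Qed.

Lemma unmixed_or_swap m : unmixed m \/ exists q q', mixed_swap q q' /\ cmdvd q m.
Proof.
case: (boolP [exists I, exists S, exists j, [&& (0 < m (xv I))%N, (0 < m (yv S))%N,
    j \in val S :\: val I & poset_ideal leP (j |: val I)]]).
  move=> /existsP[I /existsP[S /existsP[j /and4P[mI mS jSI idI]]]]; right.
  have stS : stable_set e (val S :\ j) by apply: stable_setS (valP S); apply: subD1set.
  pose I' : ideals leP := exist (poset_ideal leP) _ idI.
  pose S' : stables e := exist (stable_set e) _ stS.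
  exists (cmpair (xv I) (yv S)), (cmpair (xv I') (yv S')).
  split; last exact: cmdvd_pair.
  by exists I, S, I', S', j.
rewrite negb_exists => /forallP none; left => I S j mI mS jSI; apply/negP => idI.
have := none I; rewrite negb_exists => /forallP/(_ S).
by rewrite negb_exists => /forallP/(_ j); rewrite mI mS jSI idI.
Qed.

(** If no swap applies to [m], compare it with the smallest monomial [m0] of its fibre, to which no
    swap applies either: by [straight_unique] the two differ only in their y-parts, which share a
    fibre. *)
Lemma nonminimal_cayley m : nonminimal lev cayley_exp m ->
  (exists q q', (poset_swap q q' \/ mixed_swap q q') /\ cmdvd q m) \/
  nonminimal yle stable_exp (ypart m).
Proof.
move=> nm; have [chm|[q [q' [sw dvd]]]] := xchain_or_swap m; last first.
  by left; exists q, q'; split=> //; left.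
have [unm|[q [q' [sw dvd]]]] := unmixed_or_swap m; last first.
  by left; exists q, q'; split=> //; right.
right.
have fib : [pred m' | cayley_exp m' == cayley_exp m] m by rewrite /= eqxx.
have [m0 [/eqP E0 _ min0]] := revlex_min adm_anti adm_trans adm_total fib.
have {}min0 : ~ nonminimal lev cayley_exp m0.
  case=> m' E'; apply/negP; apply: min0; first by rewrite /= E' E0.
  exact: toric_exp_mdeg (etrans E' E0).
have min_swap q q' : poset_swap q q' \/ mixed_swap q q' -> ~ cmdvd q m0.
  move=> sw dvd; case: min0; apply: (nonminimal_dvd dvd).
  by case: sw => [/poset_swapP|/mixed_swapP] [E lt _]; exists q'.
have chm0 : xchain m0.
  have [//|[q [q' [sw dvd]]]] := xchain_or_swap m0.
  by case: (min_swap q q') => //; left.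
have unm0 : unmixed m0.
  have [//|[q [q' [sw dvd]]]] := unmixed_or_swap m0.
  by case: (min_swap q q') => //; right.
have [Ex Ey] := straight_unique leP_anti leP_trans E0 chm0 unm0 chm unm.
have nE : ypart m0 != ypart m.
  apply: contra_not_neq min0 => Eyp; suff -> : m0 = m by [].
  apply: cm_ext => -[I|S]; first exact: Ex.
  have : ypart m0 S = ypart m S by rewrite Eyp.
  by rewrite !cmfunE.
have [lt|lt] := orP (revlex_lt_total yz_refl yz_anti yz_trans (toric_exp_mdeg Ey) nE).
  by exists (ypart m0).
(* A y-part of [m] below that of [m0] would make a divisor of [m0] nonminimal. *)
case: min0; apply: (@nonminimal_dvd _ _ _ _ (yembed leP (ypart m0))).
  by apply: yembed_dvd; apply/cmdvdP.
by apply: nonminimal_yembed; exists (ypart m).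
Qed.

End CayleyInitial.

(** * Gröbner basis and squarefree initial ideal of the Cayley sum *)

Section CayleyGroebner.
Context (K : fieldType) (d : nat) (leP e : rel 'I_d).
Local Notation stablesF := (Specif_sig__canonical__fintype_Finite (stable_set e)).
Local Notation cvarF := (Datatypes_sum__canonical__fintype_Finite
  (Specif_sig__canonical__fintype_Finite (poset_ideal leP)) stablesF).
Implicit Types (m q : {cmonom cvarF}) (u : {cmonom stablesF}).
Implicit Types (I : ideals leP) (S : stables e) (j k : 'I_d).

Local Notation cayley_exp := (toric_exp (@cayley_point d leP e)).
Local Notation stable_exp := (toric_exp (@stable_point d e)).
Local Notation xv I := (inl I : cvar leP e).
Local Notation yv S := (inr S : cvar leP e).

Lemma xvarE I : xvar K leP e (val I) = pvar K (xv I).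
Proof. by rewrite /xvar valK. Qed.

Lemma yvarE S : yvar K leP e (val S) = pvar K (yv S).
Proof. by rewrite /yvar valK. Qed.

Local Notation R := {malg K[{cmonom cvar leP e}]}.

Lemma xvar_pair I1 I2 :
  xvar K leP e (val I1) * xvar K leP e (val I2) = (mono K (cmpair (xv I1) (xv I2)) : R).
Proof. by rewrite !xvarE; exact: (esym (mono_pair K (xv I1) (xv I2))). Qed.

Lemma xyvar_pair I S :
  xvar K leP e (val I) * yvar K leP e (val S) = (mono K (cmpair (xv I) (yv S)) : R).
Proof. by rewrite xvarE yvarE; exact: (esym (mono_pair K (xv I) (yv S))). Qed.

(** With its converse and the mixed analogues, this translates between the binomials as ring
    elements and the swaps of monomials. *)
Lemma poset_binomialsP g : g \in poset_binomials K leP e ->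
  exists q q', poset_swap q q' /\ g = mono K q - mono K q'.
Proof.
case/imfsetP => -[X1 X2] /=; rewrite inE => /and4P[id1 id2 n12 n21] ->.
pose I1 : ideals leP := exist (poset_ideal leP) _ id1.
pose I2 : ideals leP := exist (poset_ideal leP) _ id2.
pose I3 : ideals leP := exist (poset_ideal leP) _ (poset_idealI I1 I2).
pose I4 : ideals leP := exist (poset_ideal leP) _ (poset_idealU I1 I2).
exists (cmpair (xv I1) (xv I2)), (cmpair (xv I3) (xv I4)); split.
  by exists I1, I2, I3, I4; split=> //; apply/andP.
exact: (congr2 (fun a b : R => a - b) (xvar_pair I1 I2) (xvar_pair I3 I4)).
Qed.

Lemma poset_swap_binomial q q' : poset_swap q q' ->
  mono K q - mono K q' \in poset_binomials K leP e.
Proof.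
case=> [I1 [I2 [I3 [I4 [/andP[n12 n21] E3 E4 -> ->]]]]].
apply/imfsetP; exists (val I1, val I2) => /=.
  by rewrite inE n12 n21 (valP I1) (valP I2).
rewrite -E3 -E4.
exact: (esym (congr2 (fun a b : R => a - b) (xvar_pair I1 I2) (xvar_pair I3 I4))).
Qed.

Lemma mixed_binomialsP g : g \in mixed_binomials K leP e ->
  exists q q', mixed_swap q q' /\ g = mono K q - mono K q'.
Proof.
case/imfsetP => -[[X Y] j] /=; rewrite inE => /and5P[idX stY n0 jYX idjX] ->.
have stY' : stable_set e (Y :\ j) by apply: stable_setS stY; apply: subD1set.
pose I : ideals leP := exist (poset_ideal leP) _ idX.
pose I' : ideals leP := exist (poset_ideal leP) _ idjX.
pose S : stables e := exist (stable_set e) _ stY.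
pose S' : stables e := exist (stable_set e) _ stY'.
exists (cmpair (xv I) (yv S)), (cmpair (xv I') (yv S')); split.
  by exists I, S, I', S', j.
exact: (congr2 (fun a b : R => a - b) (xyvar_pair I S) (xyvar_pair I' S')).
Qed.

Lemma mixed_swap_binomial q q' : mixed_swap q q' ->
  mono K q - mono K q' \in mixed_binomials K leP e.
Proof.
case=> [I [S [I' [S' [j [jSI EI ES -> ->]]]]]].
apply/imfsetP; exists (val I, val S, j) => /=.
  have n0 : val S != set0 by apply/set0Pn; exists j; case/setDP: jSI.
  by rewrite in_set (valP I) (valP S) jSI n0 -EI (valP I').
rewrite -EI -ES.
exact: (esym (congr2 (fun a b : R => a - b) (xyvar_pair I S) (xyvar_pair I' S'))).
Qed.

Lemma yz_embedE (g : {malg K[{cmonom stables e}]}) :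
  yz_embed leP g = (pushm (@yembed d leP e) g : {malg K[{cmonom cvarF}]}).
Proof.
apply: psubst_pushm => u; rewrite mono_prod big_sumType /= [X in X * _]big1 => [|I _]; last first.
  by rewrite /yembed cmfunE expr0.
by rewrite mul1r; apply: eq_bigr => S _; rewrite /yembed cmfunE.
Qed.

Context (leP_anti : antisymmetric leP) (leP_trans : transitive leP).
Context (lev : rel (cvar leP e)) (lev_adm : admissible_order lev).
Local Notation yle := (yz_order lev).
Local Notation Rc := {malg K[{cmonom cvarF}]}.
Local Notation Rs := {malg K[{cmonom stablesF}]}.

(** [yembed] is injective and monotone, so no terms cancel and the leading one stays leading. *)
Lemma yembed_lead (g : Rs) u : is_lead (revlex yle) g u ->
  is_lead (revlex lev) (pushm (@yembed d leP e) g) (yembed leP u).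
Proof.
move=> [ug leadu]; split.
  rewrite -mcoeff_neq0 (coef_pushm_inj g u (@yembed_inj d leP e)).
  by rewrite mcoeff_neq0.
move=> k /pushm_supp[w wg ->]; case/orP: (leadu w wg) => [/eqP ->|lt].
  by rewrite /revlex eqxx.
by apply/orP; right; apply: revlex_lt_yembed.
Qed.

Lemma pushm_yembed_toric (g : Rs) : pushm stable_exp g = 0 ->
  pushm cayley_exp (pushm (@yembed d leP e) g) = 0.
Proof.
move=> g0; have [lift liftE] := cayley_exp_yembed leP e.
rewrite pushm_comp (eq_pushm (k := lift \o stable_exp)) // -pushm_comp.
by rewrite [X in pushm _ X]g0 pushm0.
Qed.

Definition cayley_basis (GG : {fset Rs}) (g : Rc) : Prop :=
  [\/ g \in poset_binomials K leP e, exists2 g', g' \in GG & g = yz_embed leP g'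
    | g \in mixed_binomials K leP e].

Lemma cayley_basisP (GG : {fset Rs}) (g : Rc) :
  g \in (poset_binomials K leP e `|` [fset yz_embed leP g | g in GG]
    `|` mixed_binomials K leP e)%fset <-> cayley_basis GG g.
Proof.
split=> [/fsetUP[/fsetUP[gP|/imfsetP[g' g'GG ->]]|gM]|[gP|[g' g'GG ->]|gM]].
- exact: Or31.
- by apply: Or32; exists g'.
- exact: Or33.
- by apply/fsetUP; left; apply/fsetUP; left.
- by apply/fsetUP; left; apply/fsetUP; right; apply: in_imfset.
- by apply/fsetUP; right.
Qed.

Lemma cayley_basis_toric (GG : {fset Rs}) (g : Rc) :
  (forall g', g' \in GG -> toric_ideal (@stable_point d e) g') ->
  cayley_basis GG g -> pushm cayley_exp g = 0.
Proof.
move=> GGtoric [/poset_binomialsP[q [q' [sw ->]]]|[g' g'GG ->]|/mixed_binomialsP[q [q' [sw ->]]]].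
- by apply: pushm_binom; case: (poset_swapP lev_adm sw).
- by rewrite yz_embedE; apply: pushm_yembed_toric; rewrite -toric_mapE; apply: GGtoric.
- by apply: pushm_binom; case: (mixed_swapP lev_adm sw).
Qed.

Lemma cayley_basis_neq0 (GG : {fset Rs}) (g : Rc) :
  (forall g', g' \in GG -> g' != 0) -> cayley_basis GG g -> g != 0.
Proof.
move=> GGn0 [/poset_binomialsP[q [q' [sw ->]]]|[g' g'GG ->]|/mixed_binomialsP[q [q' [sw ->]]]].
- by have [_ lt _] := poset_swapP lev_adm sw; apply: (lead_neq0 (binomial_lead K lt)).
- apply: contraNneq (GGn0 g' g'GG); rewrite yz_embedE => E0; apply/eqP/malgP => u.
  by rewrite -(coef_pushm_inj g' u (@yembed_inj d leP e)) E0 !mcoeff0.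
- by have [_ lt _] := mixed_swapP lev_adm sw; apply: (lead_neq0 (binomial_lead K lt)).
Qed.

Lemma nonminimal_cayley_lead (GG : {fset Rs}) m :
  groebner_basis (revlex yle) (toric_ideal (@stable_point d e)) GG ->
  nonminimal lev cayley_exp m ->
  exists2 q, cmdvd q m & exists2 g, cayley_basis GG g & is_lead (revlex lev) g q.
Proof.
move=> [_ _ GGlead].
case/(nonminimal_cayley leP_anti leP_trans lev_adm) => [[q [q' [sw dvd]]]|nmy].
  exists q => //; exists (mono K q - mono K q').
    case: sw => sw; first by apply: Or31; apply: poset_swap_binomial.
    by apply: Or33; apply: mixed_swap_binomial.
  by apply: binomial_lead; case: sw => [/(poset_swapP lev_adm)|/(mixed_swapP lev_adm)][].
(* The nonminimal y-part lies in the initial ideal for the stable set polytope, so a leading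
   monomial from [GG] divides it, and its embedding divides [m]. *)
have /GGlead : initial_ideal (revlex yle) (toric_ideal (K := K) (@stable_point d e))
    (mono K (ypart m)).
  apply/(initial_ideal_monomials yle (h := stable_exp)).
    by move=> g; rewrite /toric_ideal toric_mapE.
  by rewrite -[mono _ _]mul1r; apply: ideal_gen_mul; exists (ypart m).
move=> gen; have : ideal_gen (monomials (fun u => exists2 g, g \in GG & is_lead (revlex yle) g u))
    (mono K (ypart m)).
  apply: ideal_gen_sub gen => q h [g [u [gGG [lead ->]]]].
  by apply: ideal_gen_mul; exists u; [exists g|rewrite monoE].
case/monomial_ideal_dvd => u [g gGG lead] dvd; exists (yembed leP u).
  exact: yembed_dvd.
exists (yz_embed leP g); first by apply: Or32; exists g.
by rewrite yz_embedE; apply: yembed_lead.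
Qed.

(** Leading terms of swaps are products of two distinct variables; in the remaining case the radical
    of the y-part serves. *)
Lemma nonminimal_cayley_squarefree m :
  perfect e -> irreflexive e -> nonminimal lev cayley_exp m ->
  exists2 q, cmsquarefree q /\ nonminimal lev cayley_exp q & cmdvd q m.
Proof.
move=> e_perfect e_irrefl.
case/(nonminimal_cayley leP_anti leP_trans lev_adm) => [[q [q' [sw dvd]]]|nmy].
  exists q => //.
  by case: sw => [/(poset_swapP lev_adm)|/(mixed_swapP lev_adm)] [E lt sqf]; split=> //; exists q'.
have nmr := nonminimal_cmrad e_irrefl e_perfect (yz_refl lev_adm) (yz_anti lev_adm)
  (yz_trans lev_adm) (yz_total lev_adm) nmy.
exists (yembed leP (cmrad (ypart m))).
  split; last exact: nonminimal_yembed.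
  by apply/forallP => -[I|S]; rewrite cmfunE // cmfunE leq_b1.
apply: yembed_dvd; apply/cmdvdP => S; rewrite cmfunE.
by case: (ypart m S).
Qed.

End CayleyGroebner.

Theorem theorem3p2 (K : fieldType) (d : nat)
    (leP : rel 'I_d) (e : rel 'I_d) (lev : rel (cvar leP e))
    (leP_refl : reflexive leP) (leP_anti : antisymmetric leP)
    (leP_trans : transitive leP)
    (e_sym : symmetric e) (e_irrefl : irreflexive e)
    (e_perfect : perfect e)
    (lev_adm : admissible_order lev) :
  (forall GG : {fset {malg K[{cmonom stables e}]}},
     reduced_groebner_basis (revlex (yz_order lev))
       (toric_ideal (@stable_point d e)) GG ->
     groebner_basis (revlex lev)
       (toric_ideal (@cayley_point d leP e))
       (poset_binomials K leP e `|` [fset yz_embed leP g | g in GG]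
          `|` mixed_binomials K leP e)%fset) /\
  gen_by_squarefree_monomials
    (initial_ideal (revlex lev)
       (toric_ideal (K := K) (@cayley_point d leP e))).
Proof.
have toricE (g : {malg K[{cmonom _}]}) :
    toric_ideal (@cayley_point d leP e) g <-> pushm (toric_exp (@cayley_point d leP e)) g = 0.
  by rewrite /toric_ideal toric_mapE.
split=> [GG [GGgb _ _]|]; last first.
  (* The squarefree nonminimal monomials generate, since each nonminimal monomial has one of them as
     a divisor. *)
  exists (fun q => cmsquarefree q /\ nonminimal lev (toric_exp (@cayley_point d leP e)) q).
  split=> [q []//|f]; rewrite (initial_ideal_monomials lev f toricE); split.
    move=> gen; apply: (ideal_gen_sub (A := monomials (fun q => cmsquarefree q /\
        nonminimal lev (toric_exp (@cayley_point d leP e)) q))).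
      by move=> q g [m Mm ->]; apply: ideal_gen_mul; exists m => //; rewrite monoE.
    apply: monomial_ideal_sub gen => m.
    exact: nonminimal_cayley_squarefree.
  apply: ideal_gen_sub => q g [m [_ nm] ->]; apply: ideal_gen_mul.
  by exists m => //; rewrite monoE.
have [GGn0 GGtoric _] := GGgb.
have Btoric g := @cayley_basis_toric K d leP e lev lev_adm GG g GGtoric.
split=> [g|g|f].
- by move=> /cayley_basisP gB; exact: (cayley_basis_neq0 lev_adm GGn0 gB).
- by move=> /cayley_basisP gB; apply/toricE; exact: Btoric.
(* Each nonminimal monomial is divisible by a leading monomial of the basis; conversely, the basis
   lies in the toric ideal. *)
split.
  rewrite (initial_ideal_monomials lev f toricE) => gen.
  apply: (ideal_gen_sub (A := monomials
    (fun q => exists2 g, cayley_basis GG g & is_lead (revlex lev) g q))).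
    move=> q h [m [g gB lead] ->]; apply: ideal_gen_mul; exists g, m.
    by rewrite monoE; split=> //; apply/cayley_basisP.
  apply: monomial_ideal_sub gen => m /(nonminimal_cayley_lead leP_anti leP_trans lev_adm GGgb).
  by case=> q dvd [g gB lead]; exists q => //; exists g.
apply: ideal_gen_sub => q h [g [m [/cayley_basisP gB [lead ->]]]]; apply: ideal_gen_mul.
by exists g, m; split=> //; apply/toricE/Btoric.
Qed.
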